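(* Let $d\ge 1$ and let $P\in\mathbb{C}\langle x,y\rangle$ be a homogeneous noncommutative polynomial of degree $d$ whose abelianization (its image in $\mathbb{C}[x,y]$) is square-free, i.e. is a product of $d$ pairwise non-proportional (nonzero) linear factors. Let $A=\mathbb{C}\langle x,y\rangle/\langle P\rangle$, graded by $\deg x=\deg y=1$. Then: (i) For every $m\ge 2$, $B_m(A)[r]=0$ for all $r\ge 2d+2m-5$. (ii) For every $m\ge 2$, $N_m(A)[r]=0$ for all $r\ge 2d+2m-4$.
   Context: For an associative unital algebra $A$ with commutator $[a,b]=ab-ba$, set $L_1(A)=A$ and $L_{i+1}(A)=[A,L_i(A)]$ for $i\ge 1$, where $[C,D]$ denotes the linear span of all $[c,d]$ with $c\in C$, $d\in D$. Let $M_i(A)=A\cdot L_i(A)$, which is the two-sided ideal generated by $L_i(A)$. Put $B_i(A)=L_i(A)/L_{i+1}(A)$ and $N_i(A)=M_i(A)/M_{i+1}(A)$. If $A$ is graded, these spaces inherit gradings, and $Y[r]$ denotes the homogeneous component of degree $r$ of a graded space $Y$. $\mathbb{C}\langle x,y\rangle$ is the free associative algebra on $x,y$, and $\langle P\rangle$ is the two-sided ideal generated by $P$. *)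

(* Defs.v *)
From HB Require Import structures.
From mathcomp Require Import all_boot all_order all_algebra finmap.
From mathcomp Require Import boolp classical_sets reals complex.
From mathcomp.multinomials Require Import monalg.
From mathcomp.multinomials Require Import (canonicals, coercions) mpoly.

Set Implicit Arguments.
Unset Strict Implicit.
Unset Printing Implicit Defensive.

Import GRing.Theory.

Local Open Scope ring_scope.
Local Open Scope classical_set_scope.
Local Open Scope quotient_scope.

Section Span.
Variables (K : pzRingType) (V : lmodType K).

Definition lspan (S : set V) : {pred V} :=
  fun v => `[< exists s : seq (K * V),
    (forall p, p \in s -> S p.2) /\ v = \sum_(p <- s) p.1 *: p.2 >].

Lemma mem_span (S : set V) v : S v -> v \in lspan S.
Proof.
move=> Sv; apply/asboolP; exists [:: (1, v)]; split; last first.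
  by rewrite big_seq1 scale1r.
by move=> p; rewrite inE => /eqP->.
Qed.

Lemma span_submod_closed (S : set V) : submod_closed (lspan S).
Proof.
split; first by apply/asboolP; exists [::]; rewrite big_nil.
move=> a u v /asboolP[s [sS ->]] /asboolP[t [tS ->]]; apply/asboolP.
exists ([seq (a * p.1, p.2) | p <- s] ++ t); split.
  by move=> p; rewrite mem_cat => /orP[/mapP[q qs ->]|/tS]; first exact: (sS q).
rewrite big_cat big_map scaler_sumr; congr (_ + _).
by apply: eq_bigr => p _; rewrite scalerA.
Qed.

HB.instance Definition _ (S : set V) :=
  GRing.isSubmodClosed.Build K V (lspan S) (span_submod_closed S).

Lemma span_sub (S : set V) (U : submodClosed V) :
  (forall v, S v -> v \in U) -> {subset lspan S <= U}.
Proof.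
move=> SU v /asboolP[s [sS ->]]; rewrite big_seq.
by apply: rpred_sum => p ps; apply: rpredZ; apply/SU/sS.
Qed.

End Span.

Section QuotientModule.
Variables (K : pzRingType) (V : lmodType K) (U : submodClosed V).

(* submodClosed does not inherit from zmodClosed, which Quotient.quot expects. *)
Definition subgroup : {pred V} := U.

Fact subgroup_zmod_closed : zmod_closed subgroup.
Proof. exact: (GRing.submod_closedB (submodClosedP U)). Qed.
HB.instance Definition _ := GRing.isZmodClosed.Build V subgroup
  subgroup_zmod_closed.

Definition mquot : Type := Quotient.quot subgroup.

HB.instance Definition _ := GRing.Zmodule.on mquot.
HB.instance Definition _ := EqQuotient.on mquot.

Definition mproj (v : V) : mquot := \pi_mquot v.

Lemma mproj_eq v w : (mproj v = mproj w) <-> (v - w \in U).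
Proof.
by rewrite (Quotient.idealrBE subgroup); split=> [e|/eqP e]; [apply/eqP|].
Qed.

Lemma mproj_repr (x : mquot) : mproj (repr x) = x.
Proof. exact: reprK. Qed.

Lemma mproj_surj (x : mquot) : exists v, x = mproj v.
Proof. by exists (repr x); rewrite mproj_repr. Qed.

Lemma mproj_is_zmod_morphism : zmod_morphism mproj.
Proof. exact: (raddfB (\pi_(Quotient.quot subgroup))). Qed.
HB.instance Definition _ :=
  GRing.isZmodMorphism.Build V mquot mproj mproj_is_zmod_morphism.

Definition mquot_scale (k : K) (x : mquot) : mquot := mproj (k *: repr x).

Lemma mquot_scaleE k v : mquot_scale k (mproj v) = mproj (k *: v).
Proof.
by apply/mproj_eq; rewrite -scalerBr rpredZ //; apply/mproj_eq/mproj_repr.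
Qed.

Fact mquot_scalerA a b x :
  mquot_scale a (mquot_scale b x) = mquot_scale (a * b) x.
Proof. by have [v ->] := mproj_surj x; rewrite !mquot_scaleE scalerA. Qed.

Fact mquot_scale1r : left_id 1 mquot_scale.
Proof. by move=> x; have [v ->] := mproj_surj x; rewrite mquot_scaleE scale1r. Qed.

Fact mquot_scalerDr : right_distributive mquot_scale +%R.
Proof.
move=> a x y; have [v ->] := mproj_surj x; have [w ->] := mproj_surj y.
by rewrite -raddfD !mquot_scaleE scalerDr raddfD.
Qed.

Fact mquot_scalerDl x : {morph mquot_scale^~ x : a b / a + b}.
Proof.
by move=> a b; have [v ->] := mproj_surj x; rewrite !mquot_scaleE scalerDl raddfD.
Qed.

HB.instance Definition _ := GRing.Zmodule_isLmodule.Build K mquot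
  mquot_scalerA mquot_scale1r mquot_scalerDr mquot_scalerDl.

Fact mproj_is_scalable : scalable mproj.
Proof. by move=> k v; rewrite -mquot_scaleE. Qed.
HB.instance Definition _ :=
  GRing.isScalable.Build K V mquot *:%R mproj mproj_is_scalable.

End QuotientModule.

(* U / W for subspaces W <= U of V: the quotient of the module U by the
   submodule of the elements lying in W. *)
Section Subquotient.
Variables (K : pzRingType) (V : lmodType K) (U W : submodClosed V).

Definition submod : Type := {v : V | v \in U}.

HB.instance Definition _ := SubChoice.on submod.
HB.instance Definition _ := [SubChoice_isSubLmodule of submod by <:].

Definition sub_in : {pred submod} := [pred u | val u \in W].

Fact sub_in_submod_closed : submod_closed sub_in.
Proof.
split; first by rewrite inE raddf0 rpred0.
by move=> a u v; rewrite !inE linearP => uW vW; rewrite rpredD ?rpredZ.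
Qed.
HB.instance Definition _ :=
  GRing.isSubmodClosed.Build K submod sub_in sub_in_submod_closed.

Definition subquot : Type := mquot sub_in.
HB.instance Definition _ := GRing.Lmodule.on subquot.

(* Y[r] for Y = U / W: the classes of the elements of U of degree r, where
   G r is the homogeneous component of degree r of V. *)
Definition subquot_deg (G : nat -> set V) (r : nat) : set subquot :=
  [set mproj sub_in u | u in [set u : submod | G r (val u)]].

End Subquotient.

Arguments sub_in {K V} U W u.

Section LowerCentralSeries.
Variables (K : pzRingType) (A : algType K).

Definition commutator (a b : A) : A := a * b - b * a.

Definition comm_span (C D : {pred A}) : {pred A} :=
  lspan [set commutator c d | c in [set` C] & d in [set` D]].

(* Indexed from 1; the value at 0 is junk. *)
Fixpoint lcs (i : nat) : {pred A} :=
  match i with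
  | (_.+1 as j).+1 => comm_span predT (lcs j)
  | _ => predT
  end.

Fact lcs_submod_closed i : submod_closed (lcs i).
Proof. by case: i => [//|[//|i]]; apply: span_submod_closed. Qed.
HB.instance Definition _ i :=
  GRing.isSubmodClosed.Build K A (lcs i) (lcs_submod_closed i).

Definition lcs_ideal (i : nat) : {pred A} :=
  lspan [set a * l | a in [set: A] & l in [set` lcs i]].
HB.instance Definition _ i := GRing.SubmodClosed.on (lcs_ideal i).

Lemma lcs_sub i : {subset lcs i.+1 <= lcs i}.
Proof.
case: i => [//|i]; elim: i => [//|i IH].
apply: span_sub => _ [c _] [d dL <-].
by apply: mem_span; exists c => //; exists d => //; apply: IH.
Qed.

Lemma lcs_ideal_sub i : {subset lcs_ideal i.+1 <= lcs_ideal i}.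
Proof.
apply: span_sub => _ [a _] [l lL <-].
by apply: mem_span; exists a => //; exists l => //; apply: lcs_sub.
Qed.

Definition Bquot (i : nat) : lmodType K := subquot (lcs i) (lcs i.+1).
Definition Nquot (i : nat) : lmodType K :=
  subquot (lcs_ideal i) (lcs_ideal i.+1).

(* B_i(A)[r] and N_i(A)[r], for a grading G of A. *)
Definition Bdeg (G : nat -> set A) (i r : nat) : set (Bquot i) :=
  subquot_deg (U := lcs i) (W := lcs i.+1) G r.
Definition Ndeg (G : nat -> set A) (i r : nat) : set (Nquot i) :=
  subquot_deg (U := lcs_ideal i) (W := lcs_ideal i.+1) G r.

End LowerCentralSeries.

Arguments Bdeg {K A} G i r.
Arguments Ndeg {K A} G i r.

Section AlgebraQuotient.
Variables (K : pzRingType) (F : algType K) (P : F).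

Definition ideal_gen : {pred F} :=
  lspan [set x | exists a b : F, x = a * P * b].
HB.instance Definition _ := GRing.SubmodClosed.on ideal_gen.

Lemma ideal_genMl a x : x \in ideal_gen -> a * x \in ideal_gen.
Proof.
move=> /asboolP[s [sP ->]]; rewrite mulr_sumr big_seq.
apply: rpred_sum => p /sP[b [c ->]]; rewrite -scalerAr rpredZ //.
by apply: mem_span; exists (a * b), c; rewrite !mulrA.
Qed.

Lemma ideal_genMr a x : x \in ideal_gen -> x * a \in ideal_gen.
Proof.
move=> /asboolP[s [sP ->]]; rewrite mulr_suml big_seq.
apply: rpred_sum => p /sP[b [c ->]]; rewrite -scalerAl rpredZ //.
by apply: mem_span; exists b, (c * a); rewrite !mulrA.
Qed.

(* Properness of the ideal makes the quotient a nonzero ring, as the library's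
   algebra structures require. *)
Hypothesis P_proper : 1 \notin ideal_gen.

Definition alg_quot of 1 \notin ideal_gen : Type := mquot ideal_gen.
Local Notation quotF := (alg_quot P_proper).
HB.instance Definition _ := GRing.Lmodule.on quotF.

Definition alg_proj : F -> quotF := mproj ideal_gen.
HB.instance Definition _ := GRing.Linear.on alg_proj.

Lemma alg_proj_surj (x : quotF) : exists a, x = alg_proj a.
Proof. exact: mproj_surj. Qed.

Lemma alg_proj_eq a b : alg_proj a = alg_proj b <-> a - b \in ideal_gen.
Proof. exact: mproj_eq. Qed.

Definition alg_quot_one : quotF := alg_proj 1.
Definition alg_quot_mul (x y : quotF) : quotF :=
  alg_proj (repr x * repr y).

Lemma alg_quot_mulE a b :
  alg_quot_mul (alg_proj a) (alg_proj b) = alg_proj (a * b).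
Proof.
apply/mproj_eq; set a' := repr _; set b' := repr _.
have -> : a' * b' - a * b = (a' - a) * b' + a * (b' - b).
  by rewrite mulrBl mulrBr addrA subrK.
rewrite rpredD //; [apply: ideal_genMr|apply: ideal_genMl];
  exact/mproj_eq/mproj_repr.
Qed.

Fact alg_quot_mulA : associative alg_quot_mul.
Proof.
move=> x y z; have [a ->] := alg_proj_surj x; have [b ->] := alg_proj_surj y.
by have [c ->] := alg_proj_surj z; rewrite !alg_quot_mulE mulrA.
Qed.

Fact alg_quot_mul1r : left_id alg_quot_one alg_quot_mul.
Proof. by move=> x; have [a ->] := alg_proj_surj x; rewrite alg_quot_mulE mul1r. Qed.

Fact alg_quot_mulr1 : right_id alg_quot_one alg_quot_mul.
Proof. by move=> x; have [a ->] := alg_proj_surj x; rewrite alg_quot_mulE mulr1. Qed.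

Fact alg_quot_mulrDl : left_distributive alg_quot_mul +%R.
Proof.
move=> x y z; have [a ->] := alg_proj_surj x; have [b ->] := alg_proj_surj y.
have [c ->] := alg_proj_surj z.
by rewrite -[_ + _](raddfD alg_proj) !alg_quot_mulE mulrDl raddfD.
Qed.

Fact alg_quot_mulrDr : right_distributive alg_quot_mul +%R.
Proof.
move=> x y z; have [a ->] := alg_proj_surj x; have [b ->] := alg_proj_surj y.
have [c ->] := alg_proj_surj z.
by rewrite -[X in alg_quot_mul _ X](raddfD alg_proj) !alg_quot_mulE mulrDr raddfD.
Qed.

Fact alg_quot_oner_neq0 : alg_quot_one != 0.
Proof.
apply/eqP => e; move/negP: P_proper; apply; rewrite -[1]subr0.
by apply/alg_proj_eq; rewrite raddf0.
Qed.

HB.instance Definition _ := GRing.Zmodule_isNzRing.Build quotF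
  alg_quot_mulA alg_quot_mul1r alg_quot_mulr1 alg_quot_mulrDl alg_quot_mulrDr
  alg_quot_oner_neq0.

Fact alg_proj_is_monoid_morphism : monoid_morphism alg_proj.
Proof. by split=> [//|a b]; exact: (esym (alg_quot_mulE a b)). Qed.
HB.instance Definition _ :=
  GRing.isMonoidMorphism.Build F quotF alg_proj alg_proj_is_monoid_morphism.

Fact alg_quot_scalerAl (k : K) (x y : quotF) : k *: (x * y) = (k *: x) * y.
Proof.
have [a ->] := alg_proj_surj x; have [b ->] := alg_proj_surj y.
by rewrite -rmorphM -!linearZ -rmorphM scalerAl.
Qed.

Fact alg_quot_scalerAr (k : K) (x y : quotF) : k *: (x * y) = x * (k *: y).
Proof.
have [a ->] := alg_proj_surj x; have [b ->] := alg_proj_surj y.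
by rewrite -rmorphM -!linearZ -rmorphM scalerAr.
Qed.

HB.instance Definition _ := GRing.Lmodule_isLalgebra.Build K quotF
  alg_quot_scalerAl.
HB.instance Definition _ := GRing.Lalgebra_isAlgebra.Build K quotF
  alg_quot_scalerAr.

End AlgebraQuotient.

Section FreeAlgebra.
Variables (K : comNzRingType) (n : nat).

(* K<x_0, ..., x_(n-1)>, as the algebra of the free monoid of words. *)
Definition freealg : Type := {malg K[{fmonom 'I_n}]}.
HB.instance Definition _ := GRing.Lalgebra.on freealg.

Definition words (p : freealg) : {fset {fmonom 'I_n}} := msupp p.
Definition coef (w : {fmonom 'I_n}) (p : freealg) : K := mcoeff w p.

Fact freealg_scalerAr (k : K) (p q : freealg) : k *: (p * q) = p * (k *: q).
Proof.
have comm_p : @malgC {fmonom 'I_n} K k * p = p * @malgC {fmonom 'I_n} K k.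
  rewrite [LHS]fgmulUg [RHS]fgmulgU; apply: eq_bigr => w _.
  by rewrite mul1m mulm1 mulrC.
by rewrite -!mul_malgC mulrA comm_p mulrA.
Qed.
HB.instance Definition _ := GRing.Lalgebra_isAlgebra.Build K freealg
  freealg_scalerAr.

Definition fhomog (r : nat) : set freealg :=
  [set p | forall w, w \in words p -> fdeg w = r].

Lemma fhomog_proper (d : nat) (P : freealg) :
  (0 < d)%N -> fhomog d P -> 1 \notin ideal_gen P.
Proof.
move=> d_gt0 homP; apply/negP => /asboolP[s [sP E]].
pose c0 : {rmorphism {malg K[{fmonom 'I_n}]} -> K} := @mcoeff {fmonom 'I_n} K mone.
have c0P : c0 P = 0.
  by apply: mcoeff_outdom; apply: contraTN d_gt0 => /homP <-; rewrite fdeg1.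
have := congr1 (c0 : freealg -> K) E; rewrite rmorph1 raddf_sum big_seq.
rewrite big1 => [/eqP|p /sP[a [b ->]]]; first by rewrite oner_eq0.
rewrite [LHS](mcoeffZ p.1 (a * P * b) mone) -[mcoeff _ _]/(c0 _).
by rewrite !rmorphM c0P mulr0 mul0r mulr0.
Qed.

Definition abelianization (p : freealg) : mpoly.mpoly n K :=
  \sum_(w <- words p)
     coef w p *: \prod_(i <- w : seq 'I_n) mpoly.mpolyX K (mpoly.mnm1 i).

End FreeAlgebra.

(* A product of d nonzero, pairwise non-proportional linear forms. *)
Definition squarefree_form (K : comNzRingType) (d : nat) (Q : mpoly.mpoly 2 K) :=
  exists l : 'I_d -> mpoly.mpoly 2 K,
    [/\ forall i, l i != 0,
        forall i, l i \is mpoly.ishomog1 1 mpoly.mdeg,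
        forall i j (c : K), i != j -> l i != c *: l j
      & Q = \prod_(i < d) l i].

Section Main.
Variables (K : comNzRingType) (n d : nat) (P : freealg K n).
Hypotheses (d_gt0 : (0 < d)%N) (homP : fhomog d P).

(* K<x_0, ..., x_(n-1)> / <P> and its grading induced by deg x_i = 1. *)
Definition quot_alg : algType K := alg_quot (fhomog_proper d_gt0 homP).

Definition quot_deg (r : nat) : set quot_alg :=
  [set alg_proj (fhomog_proper d_gt0 homP) p | p in fhomog r].

End Main.

Arguments quot_deg {K n d P} d_gt0 homP r.

(* Main.v *)
Require Import Defs.
From HB Require Import structures.
From mathcomp Require Import all_boot all_order all_algebra finmap zify ring.
From mathcomp Require Import boolp classical_sets reals complex.
From mathcomp.multinomials Require Import monalg.
From mathcomp.multinomials Require Import (canonicals, coercions) mpoly.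

Set Implicit Arguments.
Unset Strict Implicit.
Unset Printing Implicit Defensive.

Import GRing.Theory.
Local Open Scope ring_scope.
Local Open Scope classical_set_scope.

Local Notation "⟦ a , b ⟧" :=
  (commutator a b) (at level 0, a at level 99, b at level 99).

(** Write [L_m] for the terms of the lower central series of [A] and [M_m] for
    the ideals that they generate.  The theorem follows from the vanishing of
    [L_2 / L_3] in degrees at least [2 d - 1] and from two reductions of degree
    that hold in every algebra with two generators over a field of
    characteristic zero.

    The first reduction: if [L_k] is contained in [L_(k+1)] in degrees at least
    [s], then [L_(k+1)] is contained in [L_(k+2)] in degrees at least [s + 2]
    ([graded_lcs_step]).  Indeed, for [k >= 2] the space [⟦A, L_k⟧] is spanned
    modulo [L_(k+2)] by commutators whose outer entry has degree at most 2.  The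
    reason is a pair of identities ([triple_comm2], [triple_comm]): for [l] in
    [L_k], the commutator of [l] with the sum of the products of [a1], [a2],
    [a3] in all six orders is a combination of commutators whose outer entry is
    a product of at most two of the [ai] and whose inner entry is in [L_k].  A
    word of length at least 3 is one sixth of such a sum modulo [M_2], and
    [⟦M_2, L_k⟧] is contained in [L_(k+2)], because with two generators
    [M_2 = L_2 + M_3] ([ideal2_decomp]).

    The second reduction: [M_m] is spanned modulo [M_(m+1)] by the products of
    an element of degree at most 1 with [L_m], so that the bound for
    [M_m / M_(m+1)] is worse than the one for [L_m / L_(m+1)] by one degree
    ([graded_lcs_ideal]).  Both reductions use that the product of a commutator
    with an element of [L_m] is in [M_(m+1)] ([comm_mul_lcs]), since modulo
    [M_(m+1)] it is an alternating function of three arguments that is a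
    derivation in each of them, on an algebra with two generators.

    For [L_2 / L_3], the class of [⟦f, g⟧] depends only on the images of [f] and
    [g] in the polynomial ring.  It is an alternating form [T f g] satisfying
    [T f (g h) = T (f g) h + T (f h) g], so it can be read as the class of the
    differential form [f dg] modulo exact forms, and it vanishes on the ideal of
    the abelianization [l_1 ... l_d] of [P].  As the [l_i] are pairwise
    non-proportional, forms of degree at least [d - 1] are combinations of
    multiples of the products [Q_i] of the [l_j] with [j <> i]
    ([lin_interpolation]), which reduces the question to one linear factor at a
    time.  There [f dl_i] vanishes because it is a multiple of [d(l_i Q_i)]
    modulo [l_i Q_i], and the other direction follows from Euler's formula
    ([T_one_factor]).

    Finally [P] is homogeneous, so a homogeneous element of [L_m] or [M_m] lifts
    to the free algebra as a combination of iterated commutators of homogeneous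
    elements of the same total degree ([homog_lift], [part_lcs]). *)

(** * Deciding identities in noncommutative rings *)

Inductive nc_expr :=
| NcVar of nat
| NcZero
| NcOne
| NcOpp of nc_expr
| NcAdd of nc_expr & nc_expr
| NcMul of nc_expr & nc_expr
| NcMuln of nc_expr & nat
| NcComm of nc_expr & nc_expr.

(** Coefficients are encoded by repeating signed words. *)
Fixpoint nc_monomials (e : nc_expr) : seq (bool * seq nat) :=
  let mul := allpairs (fun s t => (s.1 (+) t.1, s.2 ++ t.2)) in
  let opp := map (fun t => (~~ t.1, t.2)) in
  match e with
  | NcVar i => [:: (false, [:: i])]
  | NcZero => [::]
  | NcOne => [:: (false, [::])]
  | NcOpp e1 => opp (nc_monomials e1)
  | NcAdd e1 e2 => nc_monomials e1 ++ nc_monomials e2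
  | NcMul e1 e2 => mul (nc_monomials e1) (nc_monomials e2)
  | NcMuln e1 n => flatten (nseq n (nc_monomials e1))
  | NcComm e1 e2 => mul (nc_monomials e1) (nc_monomials e2)
                    ++ opp (mul (nc_monomials e2) (nc_monomials e1))
  end.

Definition nc_words (b : bool) (e : nc_expr) : seq (seq nat) :=
  [seq t.2 | t <- nc_monomials e & t.1 == b].

Definition nc_zero (e : nc_expr) : bool :=
  perm_eq (nc_words false e) (nc_words true e).

Section NcEval.
Variables (R : pzRingType) (env : seq R).

Fixpoint nc_eval (e : nc_expr) : R :=
  match e with
  | NcVar i => env`_i
  | NcZero => 0
  | NcOne => 1
  | NcOpp e1 => - nc_eval e1
  | NcAdd e1 e2 => nc_eval e1 + nc_eval e2
  | NcMul e1 e2 => nc_eval e1 * nc_eval e2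
  | NcMuln e1 n => nc_eval e1 *+ n
  | NcComm e1 e2 => nc_eval e1 * nc_eval e2 - nc_eval e2 * nc_eval e1
  end.

Let word (w : seq nat) : R := \prod_(i <- w) env`_i.
Let term (t : bool * seq nat) : R := (-1) ^+ t.1 * word t.2.
Let sum_terms (s : seq (bool * seq nat)) : R := \sum_(t <- s) term t.

Let sum_opp s : sum_terms [seq (~~ t.1, t.2) | t <- s] = - sum_terms s.
Proof.
rewrite /sum_terms big_map -sumrN; apply: eq_bigr => t _.
by rewrite /term signrN mulNr.
Qed.

Let sum_mul s t :
  sum_terms (allpairs (fun s t => (s.1 (+) t.1, s.2 ++ t.2)) s t) =
  sum_terms s * sum_terms t.
Proof.
rewrite /sum_terms big_allpairs_dep mulr_suml; apply: eq_bigr => u _.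
rewrite mulr_sumr; apply: eq_bigr => v _.
rewrite /term signr_addb /word big_cat /= -!mulrA; congr (_ * _).
by rewrite !mulrA commr_sign.
Qed.

Lemma nc_evalE e : nc_eval e = sum_terms (nc_monomials e).
Proof.
elim: e => /= [i|||e1 IH1|e1 IH1 e2 IH2|e1 IH1 e2 IH2|e1 IH1 n|e1 IH1 e2 IH2].
- by rewrite /sum_terms /term /word !big_seq1 mul1r.
- by rewrite /sum_terms big_nil.
- by rewrite /sum_terms /term /word big_seq1 big_nil mul1r.
- by rewrite sum_opp IH1.
- by rewrite IH1 IH2 /sum_terms big_cat.
- by rewrite IH1 IH2 sum_mul.
- elim: n => [|n IHn]; first by rewrite mulr0n /sum_terms big_nil.
  by rewrite mulrS IHn IH1 /sum_terms /= big_cat.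
- by rewrite [RHS]big_cat /= -!/(sum_terms _) sum_opp !sum_mul IH1 IH2.
Qed.

Lemma nc_zeroP e : nc_zero e -> nc_eval e = 0.
Proof.
rewrite nc_evalE /sum_terms /nc_zero => eq_words.
rewrite (bigID (fun t => t.1)) /=.
have sum_sign b : \sum_(t <- nc_monomials e | t.1 == b) term t =
    (-1) ^+ b * \sum_(w <- nc_words b e) word w.
  rewrite big_map big_filter mulr_sumr; apply: eq_bigr => t /eqP tb.
  by rewrite /term tb.
rewrite (eq_bigl (fun t => t.1 == true)); last by move=> t; case: t.1.
rewrite [X in _ + X](eq_bigl (fun t => t.1 == false)); last first.
  by move=> t; case: t.1.
by rewrite !sum_sign mulN1r mul1r (perm_big _ eq_words) addNr.
Qed.

Lemma nc_identity e1 e2 :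
  nc_zero (NcAdd e1 (NcOpp e2)) -> nc_eval e1 = nc_eval e2.
Proof. by move/nc_zeroP/eqP; rewrite subr_eq0 => /eqP. Qed.

End NcEval.

Ltac nc_mem a l :=
  match l with
  | nil => constr:(false)
  | a :: _ => constr:(true)
  | _ :: ?l' => nc_mem a l'
  end.
Ltac nc_index a l :=
  match l with
  | a :: _ => constr:(O)
  | _ :: ?l' => let n := nc_index a l' in constr:(S n)
  end.
Ltac nc_atoms t l :=
  lazymatch t with
  | GRing.zero => l
  | GRing.one _ => l
  | GRing.opp ?a => nc_atoms a l
  | GRing.add ?a ?b => let l1 := nc_atoms b l in nc_atoms a l1
  | GRing.mul ?a ?b => let l1 := nc_atoms b l in nc_atoms a l1
  | GRing.natmul ?a _ => nc_atoms a l
  | commutator ?a ?b => let l1 := nc_atoms b l in nc_atoms a l1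
  | _ => let b := nc_mem t l in
         lazymatch b with true => l | false => constr:(t :: l) end
  end.
Ltac nc_reify t l :=
  lazymatch t with
  | GRing.zero => constr:(NcZero)
  | GRing.one _ => constr:(NcOne)
  | GRing.opp ?a => let e := nc_reify a l in constr:(NcOpp e)
  | GRing.add ?a ?b =>
      let e := nc_reify a l in let f := nc_reify b l in constr:(NcAdd e f)
  | GRing.mul ?a ?b =>
      let e := nc_reify a l in let f := nc_reify b l in constr:(NcMul e f)
  | GRing.natmul ?a ?n => let e := nc_reify a l in constr:(NcMuln e n)
  | commutator ?a ?b =>
      let e := nc_reify a l in let f := nc_reify b l in constr:(NcComm e f)
  | _ => let i := nc_index t l in constr:(NcVar i)
  end.
Ltac nc_ring :=
  match goal with
  | |- @eq ?T ?a ?b =>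
    let l0 := nc_atoms b (@nil T) in
    let l := nc_atoms a l0 in
    let e := nc_reify a l in
    let f := nc_reify b l in
    change (nc_eval l e = nc_eval l f);
    apply: nc_identity; vm_compute; reflexivity
  end.

(** * Submodules and spans *)

Lemma submodN (K : pzRingType) (V : lmodType K) (U : submodClosed V) (u : V) :
  u \in U -> - u \in U.
Proof. by move=> uU; rewrite -scaleN1r rpredZ. Qed.

Lemma submodB (K : pzRingType) (V : lmodType K) (U : submodClosed V) (u v : V) :
  u \in U -> v \in U -> u - v \in U.
Proof. by move=> uU vU; rewrite rpredD ?submodN. Qed.

(** The terms of a combination are found syntactically, because unification
    would unfold commutators into differences. *)
Ltac mem_comb :=
  lazymatch goal with
  | H : ?P |- ?P => exact H
  | |- is_true (in_mem (GRing.add ?a (GRing.opp ?b)) ?M) =>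
      cut (is_true (in_mem b M));
      [cut (is_true (in_mem a M));
       [let Ha := fresh in let Hb := fresh in
        intros Ha Hb; exact: (submodB Ha Hb)|mem_comb]|mem_comb]
  | |- is_true (in_mem (GRing.add ?a ?b) ?M) =>
      cut (is_true (in_mem b M));
      [cut (is_true (in_mem a M));
       [let Ha := fresh in let Hb := fresh in
        intros Ha Hb; exact: (rpredD Ha Hb)|mem_comb]|mem_comb]
  | |- is_true (in_mem (GRing.opp ?a) ?M) =>
      cut (is_true (in_mem a M));
      [let Ha := fresh in intros Ha; exact: (submodN Ha)|mem_comb]
  | |- is_true (in_mem (GRing.natmul ?a ?n) ?M) =>
      cut (is_true (in_mem a M));
      [let Ha := fresh in intros Ha; exact: (rpredMn n Ha)|mem_comb]
  | |- _ => idtac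
  end.

Section Spans.
Variables (K : pzRingType) (V W : lmodType K).

Lemma lspan_ind (S : set V) (P : V -> Prop) :
  P 0 -> (forall k u v, P u -> P v -> P (k *: u + v)) ->
  (forall v, S v -> P v) -> forall v, v \in lspan S -> P v.
Proof.
move=> P0 Plin PS v /asboolP[s [sS ->]].
elim: s sS => [|p s IH] sS; first by rewrite big_nil.
rewrite big_cons; apply: Plin; first by apply/PS/sS/mem_head.
by apply: IH => q qs; apply: sS; rewrite inE qs orbT.
Qed.

Lemma lspan_linear (f : V -> W) (S : set V) (U : submodClosed W) :
  (forall k u v, f (k *: u + v) = k *: f u + f v) ->
  (forall v, S v -> f v \in U) -> forall v, v \in lspan S -> f v \in U.
Proof.
move=> f_lin fS; apply: lspan_ind => //.
  have := f_lin (-1) 0 0; rewrite scaleN1r oppr0 addr0 scaleN1r addNr => ->.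
  exact: rpred0.
by move=> k u v fu fv; rewrite f_lin rpredD ?rpredZ.
Qed.
End Spans.

(** * Commutators and the lower central series of an arbitrary algebra *)

Section LowerCentralSeries.
Variables (K : pzRingType) (A : algType K).
Implicit Types (a b c d e u v z : A) (k m i j : nat).

Lemma commutator_linearl b (k : K) u v :
  ⟦k *: u + v, b⟧ = k *: ⟦u, b⟧ + ⟦v, b⟧.
Proof.
rewrite /commutator mulrDl mulrDr scalerBr -scalerAl -scalerAr opprD.
by rewrite addrACA.
Qed.

Lemma commutatorC a b : ⟦a, b⟧ = - ⟦b, a⟧.
Proof. by rewrite /commutator opprB. Qed.

Lemma commutator_linearr a (k : K) u v :
  ⟦a, k *: u + v⟧ = k *: ⟦a, u⟧ + ⟦a, v⟧.
Proof.
by rewrite commutatorC commutator_linearl opprD -scalerN -!commutatorC.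
Qed.

Lemma lcs_commr k a z : z \in lcs k -> ⟦a, z⟧ \in lcs k.+1.
Proof. by case: k => [//|k] zL; apply: mem_span; exists a => //; exists z. Qed.

Lemma lcs_comml k a z : z \in lcs k -> ⟦z, a⟧ \in lcs k.+1.
Proof. by move=> zL; rewrite commutatorC rpredN lcs_commr. Qed.

Lemma lcs_linear k (f : A -> A) (U : submodClosed A) :
  (forall t u v, f (t *: u + v) = t *: f u + f v) ->
  (forall a z, z \in lcs k.+1 -> f ⟦a, z⟧ \in U) ->
  forall z, z \in lcs k.+2 -> f z \in U.
Proof.
move=> f_lin fc; apply: lspan_linear => // _ [a _] [z zL <-]; exact: fc.
Qed.

Lemma lcs_ideal_linear m (f : A -> A) (U : submodClosed A) :
  (forall t u v, f (t *: u + v) = t *: f u + f v) ->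
  (forall a z, z \in lcs m -> f (a * z) \in U) ->
  forall z, z \in lcs_ideal m -> f z \in U.
Proof.
move=> f_lin fc; apply: lspan_linear => // _ [a _] [z zL <-]; exact: fc.
Qed.

Lemma comm_lcs i j u v :
  u \in lcs i -> v \in lcs j -> ⟦u, v⟧ \in lcs (i + j).
Proof.
case: i => [_ /(lcs_commr u)|i]; first exact/lcs_sub.
elim: i u v j => [|i IH] u v j uL vL; first exact: lcs_commr.
move: u uL; apply: lcs_linear => [t u w|a u uL].
  exact: commutator_linearl.
have -> : ⟦⟦a, u⟧, v⟧ = ⟦a, ⟦u, v⟧⟧ - ⟦u, ⟦a, v⟧⟧ by nc_ring.
mem_comb; first by rewrite addSn lcs_commr ?IH.
by rewrite addSnnS IH ?lcs_commr.
Qed.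

Lemma mem_lcs_ideal m a z : z \in lcs m -> a * z \in lcs_ideal m.
Proof. by move=> zL; apply: mem_span; exists a => //; exists z. Qed.

Lemma lcs_ideal_lcs m z : z \in lcs m -> z \in lcs_ideal m.
Proof. by move=> zL; rewrite -[z]mul1r mem_lcs_ideal. Qed.

Lemma lcs_idealMl m a z : z \in lcs_ideal m -> a * z \in lcs_ideal m.
Proof.
move: z; apply: lcs_ideal_linear => [k u v|b l lL].
  by rewrite mulrDr scalerAr.
by rewrite mulrA mem_lcs_ideal.
Qed.

Lemma lcs_idealMr m a z : z \in lcs_ideal m -> z * a \in lcs_ideal m.
Proof.
move: z; apply: lcs_ideal_linear => [k u v|b l lL].
  by rewrite mulrDl scalerAl.
have -> : b * l * a = b * a * l - b * ⟦a, l⟧ by nc_ring.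
mem_comb; first exact: mem_lcs_ideal.
exact/mem_lcs_ideal/lcs_sub/lcs_commr.
Qed.

(** Modulo [L_3] the expression [⟦⟦b, c⟧ * d, e⟧] is antisymmetric in [c], [d]
    and in [d], [e], so that [c] can be moved to the last place, where being a
    commutator itself it gives an element of [L_3]. *)
Lemma comm_ideal3 z e : z \in lcs_ideal 3 -> ⟦z, e⟧ \in lcs 3.
Proof.
move: z; apply: lcs_ideal_linear => [k u v|d l].
  exact: commutator_linearl.
move: l; apply: lcs_linear => [k u v|b c cL].
  by rewrite mulrDr -scalerAr commutator_linearl.
have L2 u v : ⟦u, v⟧ \in lcs 2 by apply: (lcs_commr (k := 1)).
have L3 u v w : ⟦⟦u, v⟧, w⟧ \in lcs 3 by apply: lcs_comml.
have -> : ⟦d * ⟦b, c⟧, e⟧ =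
    ⟦⟦b, c * d⟧, e⟧ - ⟦⟦c, ⟦b, d⟧⟧, e⟧ + ⟦⟦d, ⟦b, c⟧⟧, e⟧
    + ⟦c * e, ⟦b, d⟧⟧ + ⟦⟦e, ⟦b, d⟧⟧, c⟧ + ⟦⟦b, d⟧ * e, c⟧.
  by nc_ring.
mem_comb; try exact: L3; exact: lcs_commr.
Qed.

Lemma comm_ideal3_lcs k z v :
  z \in lcs_ideal 3 -> v \in lcs k -> ⟦z, v⟧ \in lcs k.+2.
Proof.
case: k => [|k] zM; first by move=> _; apply/lcs_sub/comm_ideal3.
elim: k v => [|k IH] v vL; first exact: comm_ideal3.
move: v vL; apply: lcs_linear => [t u v|a v vL].
  exact: commutator_linearr.
have -> : ⟦z, ⟦a, v⟧⟧ = ⟦⟦z, a⟧, v⟧ + ⟦a, ⟦z, v⟧⟧ by nc_ring.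
mem_comb; last exact/lcs_commr/IH.
by apply: (@comm_lcs 3 k.+1) => //; apply: comm_ideal3.
Qed.

(** * Commutators with a product of three factors *)

(** The commutator with [l] in [L_k] behaves like a differential operator of
    order two in its other argument: on products of three factors, summed over
    all orders, it is determined by the products of at most two of them.  In the
    sums below every outer entry is a product of at most two of the [ai].  For
    [k = 2] the entry [c] is arbitrary and may be multiplied by other elements.
    For [k >= 3] it stands for an element of [L_(k-2)], which has to remain alone
    in the innermost place; this is possible only with one more entry [e].  The
    coefficients are those of a solution of the linear system that expresses the
    identities in the free algebra. *)
Definition triple_defect2 (a1 a2 a3 b c : A) : A :=
  ⟦a1 * a2, ⟦c, b * a3⟧⟧ *+ 3 - ⟦a1 * a2, ⟦b, c * a3⟧⟧ *+ 3
  + ⟦a1, ⟦b, a2 * c * a3⟧⟧ *+ 3 - ⟦a1, ⟦c, a2 * b * a3⟧⟧ *+ 3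
  + ⟦a1, ⟦a2 * a3, ⟦c, b⟧⟧⟧
  - ⟦a1, ⟦a2 * c * b, a3⟧⟧ + ⟦a1, ⟦a2 * b * c, a3⟧⟧.

Definition triple_defect (a1 a2 a3 b e c : A) : A :=
  ⟦a1 * a2, ⟦a3, ⟦b * e, c⟧⟧⟧
  - ⟦a1 * a2, ⟦b * a3, ⟦e, c⟧⟧⟧ *+ 3
  - ⟦a1 * a2, ⟦a3 * b, ⟦e, c⟧⟧⟧ *+ 3
  - ⟦a1, ⟦a2, ⟦b * e * a3, c⟧⟧⟧ *+ 2
  + ⟦a1, ⟦b * a2, ⟦e * a3, c⟧⟧⟧ *+ 2
  - ⟦a1, ⟦b * a2 * e, ⟦a3, c⟧⟧⟧ *+ 2
  + ⟦a1, ⟦a2 * e, ⟦a3 * b, c⟧⟧⟧ *+ 2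
  + ⟦a1, ⟦a2 * b * a3, ⟦e, c⟧⟧⟧ *+ 4
  - ⟦a1, ⟦a2 * e * a3, ⟦b, c⟧⟧⟧ *+ 2
  + ⟦a1, ⟦a2 * a3, ⟦e * b, c⟧⟧⟧
  + ⟦a1, ⟦a2, ⟦b, ⟦e * a3, c⟧⟧⟧⟧ *+ 2
  - ⟦a1, ⟦a2, ⟦a3 * e, ⟦b, c⟧⟧⟧⟧ *+ 2
  - ⟦a1, ⟦a2, ⟦b * a3, ⟦e, c⟧⟧⟧⟧
  + ⟦a1, ⟦a2, ⟦a3, ⟦e * b, c⟧⟧⟧⟧
  - ⟦a1, ⟦a2, ⟦a3, ⟦b * e, c⟧⟧⟧⟧
  + ⟦a1, ⟦a2, ⟦a3 * b, ⟦e, c⟧⟧⟧⟧.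

Definition sum_orders (f : A -> A -> A -> A) (a1 a2 a3 : A) : A :=
  f a1 a2 a3 + f a1 a3 a2 + f a2 a1 a3 + f a2 a3 a1 + f a3 a1 a2 + f a3 a2 a1.

Lemma triple_comm2 a1 a2 a3 b c :
  ⟦sum_orders (fun u v w => u * v * w) a1 a2 a3, ⟦b, c⟧⟧ *+ 2 =
  - sum_orders (fun u v w => triple_defect2 u v w b c) a1 a2 a3.
Proof. by rewrite /sum_orders /triple_defect2; nc_ring. Qed.

Lemma triple_comm a1 a2 a3 b e c :
  ⟦sum_orders (fun u v w => u * v * w) a1 a2 a3, ⟦b, ⟦e, c⟧⟧⟧ *+ 2 =
  - sum_orders (fun u v w => triple_defect u v w b e c) a1 a2 a3.
Proof. by rewrite /sum_orders /triple_defect; nc_ring. Qed.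

End LowerCentralSeries.

Lemma mem_divn (K : fieldType) (V : lmodType K) (U : submodClosed V)
    (n : nat) (v : V) :
  [pchar K] =i pred0 -> v *+ n.+1 \in U -> v \in U.
Proof.
move=> /pcharf0P K0 nvU; have n0 : n.+1%:R != 0 :> K by rewrite K0.
by rewrite -[v]scale1r -(mulVf n0) -scalerA scaler_nat rpredZ.
Qed.

(** * Homogeneous elements for two letters *)

Section TwoLetters.
Variables (K : fieldType) (A : algType K) (x y : A).
Implicit Types (a b c d e u v z : A) (k m i j n : nat) (w : seq bool).

Definition letter (t : bool) : A := if t then x else y.
Definition eval_word w : A := \prod_(t <- w) letter t.

Definition word_span n : {pred A} :=
  lspan [set a | exists2 w, size w = n & a = eval_word w].
HB.instance Definition _ n := GRing.SubmodClosed.on (word_span n).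

Lemma eval_word_cat w1 w2 :
  eval_word (w1 ++ w2) = eval_word w1 * eval_word w2.
Proof. exact: big_cat. Qed.

Lemma eval_word_cons t w : eval_word (t :: w) = letter t * eval_word w.
Proof. exact: big_cons. Qed.

Lemma word_span_word w : eval_word w \in word_span (size w).
Proof. by apply: mem_span; exists w. Qed.

Lemma eval_word_nil : eval_word [::] = 1.
Proof. exact: big_nil. Qed.

Lemma word_span1 : 1 \in word_span 0.
Proof. by rewrite -eval_word_nil; apply: (word_span_word [::]). Qed.

Lemma word_span_letter t : letter t \in word_span 1.
Proof. by have := word_span_word [:: t]; rewrite /eval_word big_seq1. Qed.

Lemma word_span_linear n (f : A -> A) (U : submodClosed A) :
  (forall t u v, f (t *: u + v) = t *: f u + f v) ->
  (forall w, size w = n -> f (eval_word w) \in U) ->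
  forall a, a \in word_span n -> f a \in U.
Proof. by move=> f_lin fw; apply: lspan_linear => // _ [w wn ->]; exact: fw. Qed.

Lemma word_spanM i j a b :
  a \in word_span i -> b \in word_span j -> a * b \in word_span (i + j).
Proof.
move=> aH bH; move: a aH; apply: word_span_linear => [t u v|w wi].
  by rewrite mulrDl scalerAl.
move: b bH; apply: word_span_linear => [t u v|w' wj].
  by rewrite mulrDr scalerAr.
by rewrite -eval_word_cat -wi -wj -size_cat word_span_word.
Qed.

(** The degrees are those of the entries of iterated commutators: [A] itself need
    not be graded by the length of words. *)
Fixpoint graded_lcs k r : {pred A} :=
  match k with
  | (_.+1 as k').+1 =>
      lspan [set z | exists i a j l, [/\ (i + j)%N = r, a \in word_span i,
                                      l \in graded_lcs k' j & z = ⟦a, l⟧]]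
  | _ => word_span r
  end.

Fact graded_lcs_submod_closed k r : submod_closed (graded_lcs k r).
Proof. by case: k => [|[|k]]; apply: span_submod_closed. Qed.
HB.instance Definition _ k r :=
  GRing.isSubmodClosed.Build K A (graded_lcs k r) (graded_lcs_submod_closed k r).

Lemma graded_lcs_comm k i j r a z :
  a \in word_span i -> z \in graded_lcs k.+1 j -> (i + j)%N = r ->
  ⟦a, z⟧ \in graded_lcs k.+2 r.
Proof. by move=> aH zL ijr; apply: mem_span; exists i, a, j, z. Qed.

Lemma graded_lcs_linear k r (f : A -> A) (U : submodClosed A) :
  (forall t u v, f (t *: u + v) = t *: f u + f v) ->
  (forall i j a z, (i + j)%N = r -> a \in word_span i ->
     z \in graded_lcs k.+1 j -> f ⟦a, z⟧ \in U) ->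
  forall z, z \in graded_lcs k.+2 r -> f z \in U.
Proof.
move=> f_lin fc; apply: lspan_linear => // _ [i [a [j [z [ijr aH zL ->]]]]].
exact: (fc i j a z ijr aH zL).
Qed.

Lemma graded_lcs_lcs k r z : z \in graded_lcs k r -> z \in lcs k.
Proof.
case: k => [//|k]; elim: k r z => [//|k IH] r z; move: z.
apply: (graded_lcs_linear (f := id)) => // i j a z _ _ zL.
exact/lcs_commr/(IH j).
Qed.

Lemma graded_lcs_sub k r z : z \in graded_lcs k.+2 r -> z \in graded_lcs k.+1 r.
Proof.
elim: k r z => [|k IH] r z; move: z.
  apply: (graded_lcs_linear (f := id)) => // i j a z <- aH zL.
  rewrite /= /commutator; mem_comb; first exact: word_spanM.
  by rewrite addnC; apply: word_spanM.
apply: (graded_lcs_linear (f := id)) => // i j a z ijr aH /IH zL.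
exact: graded_lcs_comm zL ijr.
Qed.

(* The last case is for iterated commutators with more entries than required. *)
Ltac homogeneous :=
  solve [eassumption | apply: word_spanM; homogeneous
        | eapply graded_lcs_comm; [homogeneous|homogeneous|reflexivity]
        | eapply graded_lcs_comm;
            [homogeneous|apply: graded_lcs_sub; homogeneous|reflexivity]].

Lemma sum_orders_mem (U : submodClosed A) (f : A -> A -> A -> A) (N : nat) :
    (forall n1 n2 n3 a1 a2 a3, (0 < n1)%N -> (0 < n2)%N -> (0 < n3)%N ->
      (n1 + n2 + n3)%N = N -> a1 \in word_span n1 -> a2 \in word_span n2 ->
      a3 \in word_span n3 -> f a1 a2 a3 \in U) ->
  forall n1 n2 n3 a1 a2 a3, (0 < n1)%N -> (0 < n2)%N -> (0 < n3)%N ->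
    (n1 + n2 + n3)%N = N -> a1 \in word_span n1 -> a2 \in word_span n2 ->
    a3 \in word_span n3 -> sum_orders f a1 a2 a3 \in U.
Proof.
move=> fU n1 n2 n3 a1 a2 a3 n1_gt0 n2_gt0 n3_gt0 nN a1H a2H a3H.
rewrite /sum_orders; mem_comb.
- exact: (fU n1 n2 n3).
- by apply: (fU n1 n3 n2) => //; lia.
- by apply: (fU n2 n1 n3) => //; lia.
- by apply: (fU n2 n3 n1) => //; lia.
- by apply: (fU n3 n1 n2) => //; lia.
- by apply: (fU n3 n2 n1) => //; lia.
Qed.

(** In [triple_comm2] and [triple_comm] all outer entries on the right have
    degree less than [N], since one or two factors have been moved inside. *)
Lemma sum_orders_comm k (U : submodClosed A) N n1 n2 n3 j a1 a2 a3 z :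
    [pchar K] =i pred0 ->
    (forall i i' b l, (i < N)%N -> b \in word_span i ->
       l \in graded_lcs k.+2 i' -> (i + i' = N + j)%N -> ⟦b, l⟧ \in U) ->
    (0 < n1)%N -> (0 < n2)%N -> (0 < n3)%N -> (n1 + n2 + n3)%N = N ->
    a1 \in word_span n1 -> a2 \in word_span n2 -> a3 \in word_span n3 ->
  z \in graded_lcs k.+2 j ->
  ⟦sum_orders (fun p q r => p * q * r) a1 a2 a3, z⟧ \in U.
Proof.
move=> K0 HU n1_gt0 n2_gt0 n3_gt0 nN a1H a2H a3H zL.
apply: (@mem_divn _ _ _ 1) => //; move: z zL.
set s := sum_orders _ _ _ _.
have s_lin (t : K) (u v : A) :
    ⟦s, t *: u + v⟧ *+ 2 = t *: (⟦s, u⟧ *+ 2) + ⟦s, v⟧ *+ 2.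
  by rewrite commutator_linearr mulrnDl scalerMnr.
case: k HU => [|k] HU.
  apply: graded_lcs_linear => [//|i i' b c iij bH cH].
  change (is_true (c \in word_span i')) in cH.
  rewrite /s triple_comm2; apply: submodN.
  move: n1 n2 n3 a1 a2 a3 n1_gt0 n2_gt0 n3_gt0 nN a1H a2H a3H {s s_lin}.
  apply: sum_orders_mem => n1 n2 n3 a1 a2 a3 n1_gt0 n2_gt0 n3_gt0 nN a1H a2H a3H.
  rewrite /triple_defect2.
  by mem_comb; (eapply HU; [|homogeneous|homogeneous|]; lia).
apply: graded_lcs_linear => [//|i i' b z iij bH].
move: z; apply: graded_lcs_linear => [t u v|i1 i2 e c i12 eH cH].
  by rewrite commutator_linearr s_lin.
rewrite /s triple_comm; apply: submodN.
move: n1 n2 n3 a1 a2 a3 n1_gt0 n2_gt0 n3_gt0 nN a1H a2H a3H {s s_lin}.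
apply: sum_orders_mem => n1 n2 n3 a1 a2 a3 n1_gt0 n2_gt0 n3_gt0 nN a1H a2H a3H.
rewrite /triple_defect.
by mem_comb; (eapply HU; [|homogeneous|homogeneous|]; lia).
Qed.

End TwoLetters.

(** * Algebras with two generators *)

Section TwoGenerators.
Variables (K : fieldType) (A : algType K) (x y : A).
Hypothesis (K0 : [pchar K] =i pred0).
Hypothesis gen_xy :
  forall a : A, a \in lspan [set a | exists w, a = eval_word x y w].
Implicit Types (a b c d e f u v z : A) (k m i j n r : nat) (w : seq bool).

Local Notation letter := (letter x y).
Local Notation eval_word := (eval_word x y).
Local Notation word_span := (word_span x y).
Local Notation graded_lcs := (graded_lcs x y).

Lemma generated_linear (g : A -> A) (U : submodClosed A) :
  (forall t u v, g (t *: u + v) = t *: g u + g v) ->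
  (forall w, g (eval_word w) \in U) -> forall a, g a \in U.
Proof.
move=> g_lin gw a; apply: (lspan_linear g_lin _ (gen_xy a)) => _ [w ->].
exact: gw.
Qed.

Lemma generated_ind (P : A -> Prop) :
  P 0 -> (forall (t : K) u v, P u -> P v -> P (t *: u + v)) ->
  P 1 -> P x -> P y -> (forall u v, P u -> P v -> P (u * v)) ->
  forall a, P a.
Proof.
move=> P0 Plin P1 Px Py PM a; apply: (lspan_ind P0 Plin _ (gen_xy a)) => _ [w ->].
elim: w => [|t w IH]; first by rewrite eval_word_nil.
by rewrite eval_word_cons; apply: PM => //; case: t.
Qed.

Section Product.
Variables (m : nat) (c : A).
Hypothesis cL : c \in lcs m.

(* The sum appears in the expansion of [⟦a, ⟦b * u, c⟧⟧]. *)
Let exchange_2_3 a b u : ⟦a, b⟧ * ⟦u, c⟧ + ⟦a, u⟧ * ⟦b, c⟧ \in lcs_ideal m.+2.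
Proof.
have L1 v : ⟦v, c⟧ \in lcs m.+1 by apply: lcs_commr.
have -> : ⟦a, b⟧ * ⟦u, c⟧ + ⟦a, u⟧ * ⟦b, c⟧ =
  ⟦a, ⟦b * u, c⟧⟧ - b * ⟦a, ⟦u, c⟧⟧ - ⟦a, ⟦b, c⟧⟧ * u - ⟦⟦b, c⟧, ⟦a, u⟧⟧.
  by nc_ring.
mem_comb.
- exact/lcs_ideal_lcs/lcs_commr.
- exact/lcs_idealMl/lcs_ideal_lcs/lcs_commr.
- exact/lcs_idealMr/lcs_ideal_lcs/lcs_commr.
- exact/lcs_ideal_lcs/lcs_comml.
Qed.

Let derivation a a' b u :
  ⟦a, b⟧ * ⟦u, c⟧ \in lcs_ideal m.+2 -> ⟦a', b⟧ * ⟦u, c⟧ \in lcs_ideal m.+2 ->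
  ⟦a * a', b⟧ * ⟦u, c⟧ \in lcs_ideal m.+2.
Proof.
move=> aM a'M; set z := ⟦a, b⟧.
have -> : ⟦a * a', b⟧ * ⟦u, c⟧ = a * (⟦a', b⟧ * ⟦u, c⟧) + a' * (⟦a, b⟧ * ⟦u, c⟧)
    + (⟦z, a'⟧ * ⟦u, c⟧ + ⟦z, u⟧ * ⟦a', c⟧)
    + (⟦u, z⟧ * ⟦a', c⟧ + ⟦u, a'⟧ * ⟦z, c⟧) - ⟦u, a'⟧ * ⟦z, c⟧.
  by rewrite /z; nc_ring.
have h1 := exchange_2_3 z a' u; have h2 := exchange_2_3 u z a'.
mem_comb; try exact: lcs_idealMl.
(* Two exchanges have moved the commutator [z] next to [c]. *)
apply: mem_lcs_ideal; rewrite -add2n; apply: comm_lcs => //; rewrite /z.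
exact: (lcs_commr (k := 1)).
Qed.

Let swap_2_3 a b u :
  ⟦a, u⟧ * ⟦b, c⟧ \in lcs_ideal m.+2 -> ⟦a, b⟧ * ⟦u, c⟧ \in lcs_ideal m.+2.
Proof.
move=> h; have h' := exchange_2_3 a b u.
by rewrite -[_ * _](addrK (⟦a, u⟧ * ⟦b, c⟧)); mem_comb.
Qed.

Let swap_1_2 a b u :
  ⟦b, a⟧ * ⟦u, c⟧ \in lcs_ideal m.+2 -> ⟦a, b⟧ * ⟦u, c⟧ \in lcs_ideal m.+2.
Proof. by move=> h; rewrite commutatorC mulNr; apply: submodN. Qed.

Let from_letters b u :
  ⟦x, b⟧ * ⟦u, c⟧ \in lcs_ideal m.+2 -> ⟦y, b⟧ * ⟦u, c⟧ \in lcs_ideal m.+2 ->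
  forall a, ⟦a, b⟧ * ⟦u, c⟧ \in lcs_ideal m.+2.
Proof.
move=> hx hy; apply: generated_ind => //.
- by rewrite (_ : ⟦0, b⟧ * ⟦u, c⟧ = 0) ?rpred0 //; nc_ring.
- move=> t v v' vM v'M; rewrite commutator_linearl mulrDl -scalerAl.
  by rewrite rpredD ?rpredZ.
- by rewrite (_ : ⟦1, b⟧ * ⟦u, c⟧ = 0) ?rpred0 //; nc_ring.
- by move=> v v'; apply: derivation.
Qed.

(** Modulo [M_(m+2)] the product is alternating in [a], [b], [u] and a
    derivation in each of them, and there are only two generators. *)
Lemma comm_mul_lcs a b u : ⟦a, b⟧ * ⟦u, c⟧ \in lcs_ideal m.+2.
Proof.
have diag v p : ⟦v, v⟧ * p \in lcs_ideal m.+2.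
  by rewrite (_ : ⟦v, v⟧ * p = 0) ?rpred0 //; nc_ring.
move: a; apply: from_letters; apply: swap_1_2; move: b; apply: from_letters => //.
  apply/swap_2_3/swap_1_2; move: u; apply: from_letters => //.
  exact/swap_2_3/diag.
apply/swap_2_3/swap_1_2; move: u; apply: from_letters => //.
exact/swap_2_3/diag.
Qed.

End Product.

Lemma comm_ideal2 a z : z \in lcs_ideal 2 -> ⟦a, z⟧ \in lcs_ideal 3.
Proof.
move: z; apply: lcs_ideal_linear => [t u u'|d l].
  exact: commutator_linearr.
move: l; apply: lcs_linear => [t u u'|p q qL].
  by rewrite mulrDr -scalerAr commutator_linearr.
have -> : ⟦a, d * ⟦p, q⟧⟧ = ⟦a, d⟧ * ⟦p, q⟧ + d * ⟦a, ⟦p, q⟧⟧ by nc_ring.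
mem_comb; first exact: comm_mul_lcs.
exact/mem_lcs_ideal/lcs_commr/lcs_commr.
Qed.

Lemma comm_ideal2_gen d u v : d * ⟦u, v⟧ \in lcs_ideal 2.
Proof. exact/mem_lcs_ideal/(lcs_commr (k := 1)). Qed.

(** Modulo [M_3] the commutator with [y] is a derivation with central values
    that kills [y], and [n] is the number of letters [x] in the word. *)
Lemma letter_count w :
  exists n, x * ⟦eval_word w, y⟧ - eval_word w * ⟦x, y⟧ *+ n \in lcs_ideal 3.
Proof.
elim: w => [|t w [n IH]].
  exists 0%N; rewrite mulr0n subr0 eval_word_nil.
  by rewrite (_ : x * ⟦1, y⟧ = 0) ?rpred0 //; nc_ring.
exists (t + n)%N; rewrite eval_word_cons.
move: IH; set e := eval_word w => IH.
have {}IH b : b * (x * ⟦e, y⟧) - b * e * ⟦x, y⟧ *+ n \in lcs_ideal 3.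
  by rewrite -mulrA -mulrnAr -mulrBr; apply: lcs_idealMl.
case: t.
  have -> : x * ⟦x * e, y⟧ - x * e * ⟦x, y⟧ *+ (true + n) =
    x * ⟦⟦x, y⟧, e⟧ + (x * (x * ⟦e, y⟧) - x * e * ⟦x, y⟧ *+ n).
    by rewrite mulrS; move: (_ *+ n) => z; nc_ring.
  have IHx := IH x; mem_comb.
  exact/mem_lcs_ideal/lcs_comml/(lcs_commr (k := 1)).
have -> : x * ⟦y * e, y⟧ - y * e * ⟦x, y⟧ *+ (false + n) =
  ⟦x, y⟧ * ⟦e, y⟧ + (y * (x * ⟦e, y⟧) - y * e * ⟦x, y⟧ *+ n).
  by rewrite add0n; move: (_ *+ n) => z; nc_ring.
have IHy := IH y; mem_comb.
exact: comm_mul_lcs.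
Qed.

Let L2M3 : {pred A} := lspan [set v | v \in lcs 2 \/ v \in lcs_ideal 3].
HB.instance Definition _ := GRing.SubmodClosed.on L2M3.

(** For a word [e] with [n] letters [x], [letter_count] shows that [x * e] and
    [y] have the commutator [(n + 1) e ⟦x, y⟧] modulo [M_3], and [n + 1] is
    invertible.  The other elements of [M_2] reduce to these, because [M_2] is
    central modulo [M_3] and a commutator is a derivation in each entry. *)
Lemma ideal2_decomp z : z \in lcs_ideal 2 -> z \in L2M3.
Proof.
have inL v : v \in lcs 2 -> v \in L2M3 by move=> vL; apply: mem_span; left.
have inM v : v \in lcs_ideal 3 -> v \in L2M3.
  by move=> vM; apply: mem_span; right.
have xy_mem f : f * ⟦x, y⟧ \in L2M3.
  move: f; apply: generated_linear => [t u v|w].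
    by rewrite mulrDl scalerAl.
  have [n] := letter_count w; set e := eval_word w => /inM wn.
  apply: (mem_divn (n := n) K0).
  have -> : e * ⟦x, y⟧ *+ n.+1 =
      ⟦x * e, y⟧ - ⟦⟦x, y⟧, e⟧ - (x * ⟦e, y⟧ - e * ⟦x, y⟧ *+ n).
    by rewrite mulrS; move: (_ *+ n) => z'; nc_ring.
  mem_comb; first exact/inL/(lcs_commr (k := 1)).
  exact/inL/lcs_sub/lcs_comml/(lcs_commr (k := 1)).
have mulM f u u' v :
    (forall g, g * ⟦u, v⟧ \in L2M3) -> (forall g, g * ⟦u', v⟧ \in L2M3) ->
    f * ⟦u * u', v⟧ \in L2M3.
  move=> hu hu'.
  have -> : f * ⟦u * u', v⟧ =
      f * u * ⟦u', v⟧ + u' * f * ⟦u, v⟧ - ⟦u', f * ⟦u, v⟧⟧ by nc_ring.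
  mem_comb => //; exact/inM/comm_ideal2/comm_ideal2_gen.
have x_mem v : forall f, f * ⟦v, x⟧ \in L2M3.
  move: v; apply: generated_ind => [f|t u v hu hv f|f|f|f|u v hu hv f].
  - by rewrite (_ : f * ⟦0, x⟧ = 0) ?rpred0 //; nc_ring.
  - by rewrite commutator_linearl mulrDr -scalerAr rpredD ?rpredZ.
  - by rewrite (_ : f * ⟦1, x⟧ = 0) ?rpred0 //; nc_ring.
  - by rewrite (_ : f * ⟦x, x⟧ = 0) ?rpred0 //; nc_ring.
  - by rewrite commutatorC mulrN submodN.
  - exact: mulM.
have y_mem v : forall f, f * ⟦v, y⟧ \in L2M3.
  move: v; apply: generated_ind => [f|t u v hu hv f|f|f|f|u v hu hv f] //.
  - by rewrite (_ : f * ⟦0, y⟧ = 0) ?rpred0 //; nc_ring.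
  - by rewrite commutator_linearl mulrDr -scalerAr rpredD ?rpredZ.
  - by rewrite (_ : f * ⟦1, y⟧ = 0) ?rpred0 //; nc_ring.
  - by rewrite (_ : f * ⟦y, y⟧ = 0) ?rpred0 //; nc_ring.
  - exact: mulM.
have uv_mem u v : forall f, f * ⟦u, v⟧ \in L2M3.
  move: u; apply: generated_ind => [f|t u u' hu hu' f|f|f|f|u u' hu hu' f].
  - by rewrite (_ : f * ⟦0, v⟧ = 0) ?rpred0 //; nc_ring.
  - by rewrite commutator_linearl mulrDr -scalerAr rpredD ?rpredZ.
  - by rewrite (_ : f * ⟦1, v⟧ = 0) ?rpred0 //; nc_ring.
  - by rewrite commutatorC mulrN submodN.
  - by rewrite commutatorC mulrN submodN.
  - exact: mulM.
move: z; apply: (lcs_ideal_linear (f := id)) => // d l.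
move: l; apply: (lcs_linear (f := fun l => d * l)) => [t u v|u v _].
  by rewrite mulrDr scalerAr.
exact: uv_mem.
Qed.

Lemma comm_ideal2_lcs k z v :
  z \in lcs_ideal 2 -> v \in lcs k -> ⟦z, v⟧ \in lcs k.+2.
Proof.
move=> /ideal2_decomp zU vL; move: z zU.
apply: lspan_linear => [t u u'|z [zL|zM]].
- exact: commutator_linearl.
- exact: comm_lcs zL vL.
- exact: comm_ideal3_lcs.
Qed.

Lemma word_mod_ideal2 a1 a2 a3 :
  (a1 * a2 * a3) *+ 6 - sum_orders (fun p q s => p * q * s) a1 a2 a3
    \in lcs_ideal 2.
Proof.
have -> : (a1 * a2 * a3) *+ 6 - sum_orders (fun p q s => p * q * s) a1 a2 a3 =
    ⟦a1, a2⟧ * a3 + a1 * ⟦a2, a3⟧ + ⟦a1, a2 * a3⟧ *+ 2 + ⟦a1 * a2, a3⟧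
    + ⟦a2, a3⟧ * a1.
  by rewrite /sum_orders; nc_ring.
have M2 u v : ⟦u, v⟧ \in lcs_ideal 2.
  exact/lcs_ideal_lcs/(lcs_commr (k := 1)).
by mem_comb;
  first [exact: M2 | exact/lcs_idealMr/M2 | exact/lcs_idealMl/M2].
Qed.

(** By induction on its length, a word in the outer place can be replaced by
    words of length at most two without changing the total degree; the inner
    entry then has degree at least [s]. *)
Lemma graded_lcs_step k s :
    (forall r z, (s <= r)%N -> z \in graded_lcs k.+2 r -> z \in lcs k.+3) ->
  forall r z, (s.+2 <= r)%N -> z \in graded_lcs k.+3 r -> z \in lcs k.+4.
Proof.
move=> IHk.
suff comm_mem i : forall j a l, (s.+2 <= i + j)%N -> a \in word_span i ->
    l \in graded_lcs k.+2 j -> ⟦a, l⟧ \in lcs k.+4.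
  move=> r z sr; move: z.
  apply: (graded_lcs_linear (f := id)) => // i j a z ijr aH zL.
  by apply: (comm_mem i j) => //; rewrite ijr.
have [n] := ubnP i; elim: n i => // n IH i i_le j a l sij aH lL.
have [i2|i3] := leqP i 2.
  by apply/lcs_commr/(IHk j) => //; lia.
move: a aH; apply: word_span_linear => [t u v|w wi].
  exact: commutator_linearl.
case: w wi => [|t1 [|t2 w]] wi; rewrite ?[size _]/= in wi; try by lia.
rewrite !eval_word_cons mulrA.
set a1 := letter t1; set a2 := letter t2; set a3 := eval_word w.
apply: (mem_divn (n := 5) K0).
set s3 := sum_orders (fun p q s => p * q * s) a1 a2 a3.
have -> : ⟦a1 * a2 * a3, l⟧ *+ 6 = ⟦(a1 * a2 * a3) *+ 6 - s3, l⟧ + ⟦s3, l⟧.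
  by nc_ring.
mem_comb.
  by apply: comm_ideal2_lcs; [exact: word_mod_ideal2|exact: graded_lcs_lcs lL].
apply: (@sum_orders_comm _ _ x y k _ i 1 1 (size w) j) => //; try lia.
- by move=> i1 i2 b v i1i bH vL iij; apply: (IH i1 _ i2) => //; lia.
- exact: word_span_letter.
- exact: word_span_letter.
- exact: word_span_word.
Qed.

(** Modulo [M_(k+3)] the element [⟦f * u, c⟧] depends on [f] like a differential
    operator of order one, which expresses [a * f * ⟦u, c⟧] by products with
    shorter left factors. *)
Lemma graded_lcs_ideal k s :
    (forall r z, (s <= r)%N -> z \in graded_lcs k.+2 r -> z \in lcs k.+3) ->
  forall i j a l, (s.+1 <= i + j)%N -> a \in word_span i ->
    l \in graded_lcs k.+2 j -> a * l \in lcs_ideal k.+3.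
Proof.
move=> IHk i; have [n] := ubnP i; elim: n i => // n IH i i_le j a l sij aH lL.
have [i1|i2] := leqP i 1.
  by apply/mem_lcs_ideal/(IHk j) => //; lia.
move: a aH; apply: word_span_linear => [t u v|w wi].
  by rewrite mulrDl scalerAl.
case: w wi => [|t w] wi; rewrite ?[size _]/= in wi; first by lia.
rewrite !eval_word_cons; set a := letter t; set f := eval_word w.
have aH : a \in word_span 1 by exact: word_span_letter.
have fH : f \in word_span (size w) by exact: word_span_word.
have oneH : 1 \in word_span 0 by exact: word_span1.
move: l lL; apply: graded_lcs_linear => [t' u v|i' j' u c ij' uH cL].
  by rewrite mulrDr scalerAr.
have cL' : c \in lcs k.+1 by exact: graded_lcs_lcs cL.
have -> : a * f * ⟦u, c⟧ = a * ⟦f * u, c⟧ + f * ⟦a * u, c⟧ - 1 * ⟦a * f * u, c⟧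
    + ⟦⟦a, c⟧, f⟧ * u + ⟦a, f⟧ * ⟦u, c⟧ by nc_ring.
mem_comb.
- apply: (IH 1%N _ (size w + i' + j')%N) => //; try lia.
  apply: graded_lcs_comm (erefl _) => //; exact: word_spanM.
- apply: (IH (size w) _ (1 + i' + j')%N) => //; try lia.
  apply: graded_lcs_comm (erefl _) => //; exact: word_spanM.
- apply: (IH 0%N _ (1 + size w + i' + j')%N) => //; try lia.
  by apply: graded_lcs_comm (erefl _) => //; do 2?apply: word_spanM.
- exact/lcs_idealMr/lcs_ideal_lcs/lcs_comml/lcs_commr.
- exact: comm_mul_lcs.
Qed.

End TwoGenerators.

(** * Products of linear forms *)

Section LinearForms.
Variables (K : fieldType) (C : comAlgType K).
Implicit Types (u v w : K * K) (us vs ws : seq (K * K)).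

Definition lin (x y : C) v : C := v.1 *: x + v.2 *: y.
Definition prod_lin (x y : C) vs : C := \prod_(v <- vs) lin x y v.
Definition det2 v w : K := v.1 * w.2 - v.2 * w.1.

Lemma prod_lin_nil x y : prod_lin x y [::] = 1.
Proof. exact: big_nil. Qed.

Lemma prod_lin_cons x y v vs : prod_lin x y (v :: vs) = lin x y v * prod_lin x y vs.
Proof. exact: big_cons. Qed.

Lemma prod_lin_cat x y vs ws :
  prod_lin x y (vs ++ ws) = prod_lin x y vs * prod_lin x y ws.
Proof. exact: big_cat. Qed.

Lemma prod_lin_second x y n : prod_lin x y (nseq n (0, 1)) = y ^+ n.
Proof.
elim: n => [|n IH] /=; first by rewrite prod_lin_nil expr0.
by rewrite prod_lin_cons IH exprS /lin scale0r add0r scale1r.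
Qed.

Lemma prod_lin_head x y vs :
  exists f, prod_lin x y vs = (\prod_(v <- vs) v.2) *: y ^+ size vs + x * f.
Proof.
elim: vs => [|v vs [f IH]].
  by exists 0; rewrite prod_lin_nil big_nil expr0 scale1r mulr0 addr0.
exists (v.1 *: prod_lin x y vs + v.2 *: (y * f)).
rewrite prod_lin_cons big_cons /= exprS {1}/lin mulrDl {2}IH.
rewrite mulrDr !mulrDr -!scalerAl -!scalerAr scalerA.
rewrite addrC -!addrA; congr (_ + _).
by rewrite addrC mulrCA.
Qed.

(** Coordinates adapted to the factor [lin x y v]: it becomes the first one, and
    the factors that are not proportional to it do not vanish on its zero
    line. *)
Lemma change_basis v x y : v != 0 ->
  exists m c, forall w, lin x y w = lin (lin x y v) m (c w) /\
    (det2 v w != 0 -> (c w).2 != 0).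
Proof.
have [v10|v10 v0] := boolP (v.1 != 0); last have v20 : v.2 != 0.
- exists y, (fun w => (w.1 / v.1, det2 v w / v.1)) => w; split=> [|vw] /=.
    rewrite /lin /det2 /= scalerDr !scalerA mulfVK // -addrA -scalerDl.
    by congr (_ + _ *: _); field.
  by rewrite mulf_neq0 ?invr_eq0.
- apply: contraNneq v0 => v20; move: v10 v20; case: v => v1 v2 /=.
  by rewrite negbK => /eqP-> ->.
exists x, (fun w => (w.2 / v.2, - (det2 v w / v.2))) => w; split=> [|vw] /=.
  rewrite /lin /det2 /= scalerDr !scalerA mulfVK // addrAC -scalerDl.
  by congr (_ *: _ + _); field.
by rewrite oppr_eq0 mulf_neq0 ?invr_eq0.
Qed.

Lemma lin_det u v w x y : det2 u v != 0 ->
  lin x y w =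
    (det2 w v / det2 u v) *: lin x y u + (det2 u w / det2 u v) *: lin x y v.
Proof.
rewrite /lin => uv; rewrite !scalerDr !scalerA addrACA -!scalerDl.
by congr (_ *: _ + _ *: _); move: uv; rewrite /det2 => uv; field.
Qed.

Lemma det2C v w : det2 v w = - det2 w v.
Proof. by rewrite /det2; ring. Qed.

(** Lagrange interpolation: forms of degree at least [d - 1] are combinations of
    multiples of the products of all but one of [d] pairwise non-proportional
    linear forms.  In the induction the first factor [r] of [us] is a combination
    of the new form [v0] and of the form [v] omitted so far. *)
Lemma lin_interpolation x y (U : C -> Prop) ls us :
    (forall f g, U f -> U g -> U (f + g)) -> (forall t f, U f -> U (t *: f)) ->
    pairwise (fun v w => det2 v w != 0) ls -> (0 < size ls <= (size us).+1)%N ->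
    (forall ls1 v ls2 us', ls = ls1 ++ v :: ls2 ->
       (size us' + size ls)%N = (size us).+1 ->
       U (prod_lin x y (ls1 ++ ls2) * prod_lin x y us')) ->
  U (prod_lin x y us).
Proof.
elim: ls us U => [//|v0 ls IH] us U UD UZ pw /andP[_ le_us] Usplit.
have [ls0|ls_gt0] := posnP (size ls).
  have := Usplit [::] v0 [::] us; rewrite prod_lin_nil mul1r; apply.
    by rewrite (size0nil ls0).
  by rewrite /= ls0 addn1.
case: us le_us Usplit => [|r us] le_us Usplit; first by rewrite /= in le_us; lia.
rewrite prod_lin_cons; apply: (IH us (fun f => U (lin x y r * f))) => //.
- by move=> f g Uf Ug; rewrite mulrDr; apply: UD.
- by move=> t f Uf; rewrite -scalerAr; apply: UZ.
- by move: pw; rewrite pairwise_cons => /andP[].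
- by rewrite ls_gt0.
move=> ls1 v ls2 us' def_ls size_us'.
have v0v : det2 v0 v != 0.
  move: pw; rewrite pairwise_cons => /andP[/allP v0ls _]; apply: v0ls.
  by rewrite def_ls mem_cat mem_head orbT.
rewrite (lin_det r x y v0v) mulrDl -!scalerAl; apply: UD; apply: UZ.
  rewrite mulrA -prod_lin_cons -cat_cons; apply: (Usplit (v0 :: ls1) v) => /=.
    by rewrite def_ls.
  by lia.
have -> : lin x y v * (prod_lin x y (ls1 ++ ls2) * prod_lin x y us') =
    prod_lin x y ([::] ++ ls) * prod_lin x y us'.
  by rewrite def_ls /= !prod_lin_cat prod_lin_cons; ring.
by apply: (Usplit [::] v0) => //=; lia.
Qed.

End LinearForms.

(** * Cyclic forms *)

(** [T f g] plays the part of the differential form [f dg] modulo exact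
    forms. *)
Section CyclicForm.
Variables (K : fieldType) (C : comAlgType K) (V : lmodType K) (T : C -> C -> V).
Hypothesis K0 : [pchar K] =i pred0.
Hypothesis T_linear : forall (t : K) f f' g, T (t *: f + f') g = t *: T f g + T f' g.
Hypothesis T_anti : forall f g, T f g = - T g f.
Hypothesis T_leibniz : forall f g h, T f (g * h) = T (f * g) h + T (f * h) g.

Let TD f f' g : T (f + f') g = T f g + T f' g.
Proof. by have := T_linear 1 f f' g; rewrite !scale1r. Qed.

Let T0 g : T 0 g = 0.
Proof. by apply: (addrI (T 0 g)); rewrite -TD !addr0. Qed.

Let TZ t f g : T (t *: f) g = t *: T f g.
Proof. by rewrite -[t *: f]addr0 T_linear T0 addr0. Qed.

Let T_linr f t g g' : T f (t *: g + g') = t *: T f g + T f g'.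
Proof. by rewrite T_anti T_linear opprD -scalerN -!T_anti. Qed.

Let torsion_free (n : nat) (v : V) : v *+ n.+1 = 0 -> v = 0.
Proof.
move: K0 => /pcharf0P/(_ n.+1) n0 /eqP.
by rewrite -scaler_nat scaler_eq0 n0 => /eqP.
Qed.

Let T_1r f : T f 1 = 0.
Proof.
have /eqP := T_leibniz f 1 1; rewrite !mulr1 -subr_eq0 opprD addrA subrr add0r.
by rewrite oppr_eq0 => /eqP.
Qed.

Let T_exp f g n : T f (g ^+ n.+1) = T (f * g ^+ n) g *+ n.+1.
Proof.
elim: n f => [|n IH] f; first by rewrite expr0 mulr1.
by rewrite exprS T_leibniz IH -mulrA -exprS [RHS]mulrSr.
Qed.

Section OneFactor.
Variables (l m : C) (qs : seq (K * K)).
Hypothesis qs_neq0 : all (fun q => q.2 != 0) qs.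
Let Q := prod_lin l m qs.
Let e := size qs.
Hypothesis T_ideal : forall f g, T (l * Q * f) g = 0.

(* Both products are multiples of a power of [m] modulo [l], and [Q] is a
   nonzero one. *)
Let mod_l us : (e <= size us)%N ->
  exists c f, prod_lin l m us = c *: (Q * m ^+ (size us - e)) + l * f.
Proof.
move=> le_e; have [f fP] := prod_lin_head l m us.
have [g gP] := prod_lin_head l m qs; rewrite -/Q -/e in gP.
move: gP fP; set c0 := \prod_(v <- qs) _; set c := \prod_(v <- us) _ => gP fP.
have c0_neq0 : c0 != 0 by rewrite /c0 prodf_seq_neq0.
set r := (size us - e)%N; exists (c / c0), (f - (c / c0) *: (g * m ^+ r)).
rewrite fP gP -(subnK le_e) -/r addnC exprD mulrBr.
rewrite mulrDl scalerDr -scalerAl scalerA mulfVK //.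
by rewrite -[l * g * _]mulrA -[l * (_ *: _)]scalerAr [l * f - _]addrC addrA addrK.
Qed.

(* From [d(l Q) = l dQ + Q dl] multiplied by [Q m ^ s]. *)
Let T_square_l s : T (Q * Q * m ^+ s) l = 0.
Proof.
have := T_leibniz (Q * m ^+ s) l Q.
rewrite T_anti -[l * Q]mulr1 T_ideal oppr0.
have -> : Q * m ^+ s * l = l * Q * m ^+ s by ring.
by rewrite T_ideal add0r mulrAC => /esym.
Qed.

Let T_l us : (e <= size us)%N -> T (Q * prod_lin l m us) l = 0.
Proof.
move=> /mod_l[c [f ->]].
rewrite mulrDr -scalerAr T_linear [Q * (Q * _)]mulrA T_square_l.
by rewrite scaler0 add0r mulrCA mulrA T_ideal.
Qed.

(* Euler's formula for the form [prod_lin l m rs]: the multiples of [dl] drop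
   out by [T_l], and those of [l] because [T] vanishes on [l Q]. *)
Let T_euler us rs : (e <= size us + size rs)%N ->
  T (m * Q * prod_lin l m us) (prod_lin l m rs) =
  T (Q * prod_lin l m us * prod_lin l m rs) m *+ size rs.
Proof.
elim: rs us => [|r rs IH] us le_e; first by rewrite prod_lin_nil T_1r.
rewrite prod_lin_cons T_leibniz.
have -> : m * Q * prod_lin l m us * lin l m r = m * Q * prod_lin l m (r :: us).
  by rewrite prod_lin_cons; ring.
rewrite IH; last by move: le_e => /=; lia.
set h := prod_lin l m us; set R := prod_lin l m rs.
have -> : T (m * Q * h * R) (lin l m r) = T (Q * h * (lin l m r * R)) m.
  rewrite [X in T _ X]/lin T_linr -[r.2 *: m]addr0 T_linr [T _ 0]T_anti T0.
  rewrite oppr0 addr0.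
  have -> : m * Q * h * R = Q * prod_lin l m ((0, 1) :: us ++ rs).
    rewrite prod_lin_cons prod_lin_cat /lin scale0r scale1r add0r -/h -/R.
    by ring.
  rewrite T_l; last by rewrite /= size_cat; move: le_e => /=; lia.
  rewrite scaler0 add0r prod_lin_cons prod_lin_cat -/h -/R.
  rewrite {1}/lin scale0r scale1r add0r /lin mulrDl mulrDr TD.
  rewrite -[r.1 *: l * R]scalerAl -scalerAr TZ.
  have -> : Q * h * (l * R) = l * Q * (h * R) by ring.
  rewrite T_ideal scaler0 add0r -[r.2 *: m * R]scalerAl -scalerAr TZ.
  by congr (_ *: T _ m); ring.
rewrite prod_lin_cons -/h -/R.
have -> : Q * (lin l m r * h) * R = Q * h * (lin l m r * R) by ring.
by rewrite /= mulrSr.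
Qed.

(* [d(Q ^ 2 m ^ (t + 1))] is exact and equals [2 e + t + 1] times
   [Q ^ 2 m ^ t dm], where [2 e] comes from [T_euler] for [Q]. *)
Let T_square_m t : T (Q * Q * m ^+ t) m = 0.
Proof.
apply: (@torsion_free (e + e + t)).
have euler := @T_euler (nseq t (0, 1)) qs.
rewrite prod_lin_second size_nseq -/Q -/e in euler.
have {}euler := euler (leq_addl _ _).
have sqr : T (Q * Q) (m ^+ t.+1) + T (m * Q * m ^+ t) Q *+ 2 = 0.
  have := T_leibniz Q Q (m ^+ t.+1); rewrite T_anti => /eqP.
  rewrite eq_sym -subr_eq0 opprK => /eqP.
  have -> : Q * m ^+ t.+1 = m * Q * m ^+ t by rewrite exprS; ring.
  by rewrite mulr2n addrA.
rewrite -sqr T_exp euler mulrAC -mulrnA muln2 -mulrnDr.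
by congr (_ *+ _); lia.
Qed.

(** By [mod_l] only the multiples of [Q ^ 2 m ^ t] are left modulo [l Q]. *)
Lemma T_one_factor us w : (e <= size us)%N ->
  T (Q * prod_lin l m us) (lin l m w) = 0.
Proof.
move=> le_e; rewrite /lin T_linr T_l // scaler0 add0r.
rewrite -[w.2 *: m]addr0 T_linr [T _ 0]T_anti T0 oppr0 addr0.
have [c [f ->]] := mod_l le_e.
rewrite mulrDr -scalerAr T_linear [Q * (Q * _)]mulrA T_square_m scaler0 add0r.
by rewrite mulrCA mulrA T_ideal scaler0.
Qed.

End OneFactor.

Variables (x y : C) (ls : seq (K * K)).
Hypothesis ls_gt0 : (0 < size ls)%N.
Hypothesis ls_neq0 : all (fun v => v != 0) ls.
Hypothesis ls_det : pairwise (fun v w => det2 v w != 0) ls.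
Hypothesis T_ideal : forall f g, T (prod_lin x y ls * f) g = 0.

Lemma T_lin us w : (2 * (size ls).-1 <= size us)%N ->
  T (prod_lin x y us) (lin x y w) = 0.
Proof.
move=> le_us.
apply: (lin_interpolation (U := fun f => T f (lin x y w) = 0) _ _ ls_det).
- by move=> f g Tf Tg; rewrite TD Tf Tg addr0.
- by move=> t f Tf; rewrite TZ Tf scaler0.
- by rewrite ls_gt0 /=; lia.
move=> ls1 v ls2 us' def_ls size_us'.
have v_neq0 : v != 0.
  by apply: (allP ls_neq0); rewrite def_ls mem_cat mem_head orbT.
have [m [c cP]] := change_basis x y v_neq0.
have prod_c vs : prod_lin x y vs = prod_lin (lin x y v) m (map c vs).
  by rewrite /prod_lin big_map; apply: eq_bigr => u _; case: (cP u).
rewrite !prod_c (proj1 (cP w)); apply: T_one_factor.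
- rewrite all_map; apply/allP => u u_ls; apply: (proj2 (cP u)).
  move: ls_det; rewrite def_ls pairwise_cat allrel_consr => /and3P[/andP[vls1 _] _].
  rewrite pairwise_cons => /andP[/allP vls2 _].
  move: u_ls; rewrite mem_cat => /orP[/(allP vls1)|/vls2 //].
  by rewrite det2C oppr_eq0.
- move=> f g; rewrite -prod_c -[RHS](T_ideal f g) def_ls !prod_lin_cat prod_lin_cons.
  by congr (T (_ * f) g); ring.
- move: size_us' le_us; rewrite def_ls !size_map !size_cat /=; lia.
Qed.

(** [f dg] is a combination of forms [h dw] with [w] a linear factor of [g], to
    which [T_lin] applies: [h] has degree one less than [f * g]. *)
Lemma T_prod_lin us ws : (2 * size ls <= (size us + size ws).+1)%N ->
  T (prod_lin x y us) (prod_lin x y ws) = 0.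
Proof.
elim: ws us => [|w ws IH] us le_us; first by rewrite prod_lin_nil T_1r.
rewrite prod_lin_cons T_leibniz.
rewrite [X in T X _ + _]mulrC -prod_lin_cons IH; last by move: le_us => /=; lia.
rewrite -prod_lin_cat T_lin ?addr0 //.
by rewrite size_cat; move: le_us => /=; lia.
Qed.

End CyclicForm.

(** * Commutators modulo the third term *)

Definition letter_form (K : fieldType) (t : bool) : K * K :=
  if t then (1, 0) else (0, 1).

Section SecondQuotient.
Variables (K : fieldType) (A : algType K) (x y : A).
Hypothesis (K0 : [pchar K] =i pred0).
Hypothesis gen_xy :
  forall a : A, a \in lspan [set a | exists w, a = eval_word x y w].
Implicit Types (w : seq bool) (f g h : mpoly.mpoly 2 K) (a b c : A).

Let X : mpoly.mpoly 2 K := mpoly.mpolyX K (mpoly.mnm1 ord0).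
Let Y : mpoly.mpoly 2 K := mpoly.mpolyX K (mpoly.mnm1 ord_max).

Definition mod_ideal2 a b : Prop := a - b \in lcs_ideal 2.

Lemma mod_ideal2_trans b a c : mod_ideal2 a b -> mod_ideal2 b c -> mod_ideal2 a c.
Proof.
by rewrite /mod_ideal2 => ab bc; have := rpredD ab bc; rewrite addrA subrK.
Qed.

Lemma mod_ideal2M a a' b b' :
  mod_ideal2 a a' -> mod_ideal2 b b' -> mod_ideal2 (a * b) (a' * b').
Proof.
rewrite /mod_ideal2 => aM bM.
have -> : a * b - a' * b' = (a - a') * b + a' * (b - b') by nc_ring.
by mem_comb; [exact: lcs_idealMr|exact: lcs_idealMl].
Qed.

Lemma mod_ideal2C a b : mod_ideal2 (a * b) (b * a).
Proof. exact/lcs_ideal_lcs/(lcs_commr (k := 1)). Qed.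

Lemma mod_ideal2_comm a a' b b' : mod_ideal2 a a' -> mod_ideal2 b b' ->
  ⟦a, b⟧ - ⟦a', b'⟧ \in lcs 3.
Proof.
move=> aM bM.
have -> : ⟦a, b⟧ - ⟦a', b'⟧ = ⟦a - a', b⟧ - ⟦b - b', a'⟧ by nc_ring.
by apply: submodB; apply: (comm_ideal2_lcs K0 gen_xy (k := 1)).
Qed.

(** A linear section of the projection to the abelianization: the monomials are
    sent to the ordered words. *)
Definition section f : A :=
  mpoly.mmap (in_alg A) (fun i => if i == ord0 then x else y) f.

Lemma sectionD f g : section (f + g) = section f + section g.
Proof. exact: mpoly.mmapD. Qed.

Lemma sectionZ (t : K) f : section (t *: f) = t *: section f.
Proof. by rewrite /section mpoly.mmapZ /= mulr_algl. Qed.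

Lemma section_linear (t : K) f g : section (t *: f + g) = t *: section f + section g.
Proof. by rewrite sectionD sectionZ. Qed.

Lemma sectionX m : section (mpoly.mpolyX K m) = x ^+ m ord0 * y ^+ m ord_max.
Proof.
rewrite /section mpoly.mmapX /mpoly.mmap1 big_ord_recl big_ord1 eqxx.
by have -> : lift ord0 ord0 = ord_max :> 'I_2 by apply/val_inj.
Qed.

Lemma section1 : section 1 = 1.
Proof. by rewrite -mpoly.mpolyX0 sectionX !mpoly.mnm0E !expr0 mulr1. Qed.

Lemma section_x : section X = x.
Proof. by rewrite sectionX !mpoly.mnm1E expr1 expr0 mulr1. Qed.

Lemma section_y : section Y = y.
Proof. by rewrite sectionX !mpoly.mnm1E expr1 expr0 mul1r. Qed.

Lemma sectionM f g : mod_ideal2 (section (f * g)) (section f * section g).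
Proof.
rewrite /mod_ideal2; elim/mpoly.mpolyind: f => [|c m f _ _ IHf].
  by rewrite mul0r /section mpoly.mmap0 mul0r subr0 rpred0.
rewrite mulrDl -scalerAl !section_linear mulrDl -scalerAl opprD addrACA -scalerBr.
rewrite rpredD // rpredZ //; elim/mpoly.mpolyind: g {f IHf} => [|c' m' g _ _ IHg].
  by rewrite mulr0 /section mpoly.mmap0 mulr0 subr0 rpred0.
rewrite mulrDr -scalerAr !section_linear mulrDr -scalerAr opprD addrACA -scalerBr.
rewrite rpredD // rpredZ // -mpoly.mpolyXD !sectionX !mpoly.mnmDE !exprD.
move: (x ^+ _) (x ^+ _) (y ^+ _) (y ^+ _) => a' a b' b.
have -> : a * a' * (b * b') - a * b * (a' * b') = a * ⟦a', b⟧ * b' by nc_ring.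
exact/lcs_idealMr/comm_ideal2_gen.
Qed.

Lemma section_word w :
  mod_ideal2 (section (prod_lin X Y (map (letter_form K) w))) (eval_word x y w).
Proof.
elim: w => [|t w IH].
  rewrite prod_lin_nil section1 /eval_word big_nil.
  by rewrite /mod_ideal2 subrr rpred0.
rewrite /= prod_lin_cons eval_word_cons.
apply: mod_ideal2_trans (sectionM _ _) _; apply: mod_ideal2M => //.
rewrite /lin sectionD !sectionZ section_x section_y /mod_ideal2.
by case: t; rewrite /= scale1r scale0r ?addr0 ?add0r subrr rpred0.
Qed.

Variable ls : seq (K * K).
Hypothesis ls_gt0 : (0 < size ls)%N.
Hypothesis ls_neq0 : all (fun v => v != 0) ls.
Hypothesis ls_det : pairwise (fun u v => det2 u v != 0) ls.
Hypothesis ls_ideal : section (prod_lin X Y ls) \in lcs_ideal 2.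

Let T f g : mquot (lcs (A := A) 3) := mproj (lcs 3) ⟦section f, section g⟧.

Lemma graded_lcs2 r z : (2 * size ls <= r.+1)%N ->
  z \in graded_lcs x y 2 r -> z \in lcs 3.
Proof.
move=> le_r; have T0 us ws : (2 * size ls <= (size us + size ws).+1)%N ->
    T (prod_lin X Y us) (prod_lin X Y ws) = 0.
  apply: T_prod_lin => //.
  - by move=> t f f' g; rewrite /T section_linear commutator_linearl linearP.
  - by move=> f g; rewrite /T commutatorC raddfN.
  - move=> f g h; rewrite /T -raddfD; apply/mproj_eq.
    have -> : ⟦section f, section (g * h)⟧ -
      (⟦section (f * g), section h⟧ + ⟦section (f * h), section g⟧) =
      (⟦section f, section (g * h)⟧ - ⟦section f, section g * section h⟧)
      - (⟦section (f * g), section h⟧ - ⟦section f * section g, section h⟧)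
      - (⟦section (f * h), section g⟧ - ⟦section h * section f, section g⟧).
      by move: (section (g * h)) (section (f * g)) (section (f * h)) => *; nc_ring.
    have refl a : mod_ideal2 a a by rewrite /mod_ideal2 subrr rpred0.
    apply: submodB; [apply: submodB|]; apply: mod_ideal2_comm => //;
      try exact: sectionM.
    exact: mod_ideal2_trans (sectionM _ _) (mod_ideal2C _ _).
  - move=> f g; rewrite /T -(raddf0 (mproj (lcs (A := A) 3))); apply/mproj_eq.
    rewrite subr0; apply: (comm_ideal2_lcs K0 gen_xy (k := 1)) => //.
    have := sectionM (prod_lin X Y ls) f; rewrite /mod_ideal2 => sM.
    rewrite -[section _](subrK (section (prod_lin X Y ls) * section f)).
    by mem_comb; exact: lcs_idealMr.
move: z; apply: (graded_lcs_linear (f := id)) => // i j a z ijr aH zL.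
change (is_true (z \in word_span x y j)) in zL.
move: a aH; apply: word_span_linear => [t u v|w wi].
  exact: commutator_linearl.
move: z zL; apply: word_span_linear => [t u v|w' wj].
  exact: commutator_linearr.
have := T0 (map (letter_form K) w) (map (letter_form K) w').
rewrite !size_map wi wj ijr => /(_ le_r).
rewrite /T -(raddf0 (mproj (lcs (A := A) 3))) => /mproj_eq; rewrite subr0 => Tw.
have := mod_ideal2_comm (section_word w) (section_word w').
by move=> /(submodB Tw); rewrite opprB addrC subrK.
Qed.

End SecondQuotient.

(** * Homogeneous components *)

(** [part r p] is the component of degree [r] of [p]; its values on words and
    linearity determine it. *)
Section HomogeneousPart.
Variables (K : fieldType) (F : algType K) (x y : F).
Hypothesis gen_xy :
  forall p : F, p \in lspan [set a | exists w, a = eval_word x y w].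
Variable part : nat -> F -> F.
Hypothesis part_linear : forall r (t : K) p q,
  part r (t *: p + q) = t *: part r p + part r q.
Hypothesis part_word : forall r w,
  part r (eval_word x y w) = if size w == r then eval_word x y w else 0.
Implicit Types (p q a z : F) (w : seq bool) (r : nat).

Lemma part0 r : part r 0 = 0.
Proof.
have := part_linear r (-1) 0 0.
by rewrite scaleN1r oppr0 addr0 scaleN1r addNr.
Qed.

Lemma partB r p q : part r (p - q) = part r p - part r q.
Proof. by rewrite addrC -scaleN1r part_linear scaleN1r addrC. Qed.

Lemma part_mem r p : part r p \in word_span x y r.
Proof.
apply: (lspan_linear (part_linear r) _ (gen_xy p)) => _ [w ->].
rewrite part_word; case: eqP => [<-|_]; last exact: rpred0.
exact: word_span_word.
Qed.

Lemma partM r p q :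
  part r (p * q) = \sum_(i < r.+1) part i p * part (r - i) q.
Proof.
move: p (gen_xy p); apply: lspan_ind => [|t u v hu hv|_ [w ->]].
- by rewrite mul0r part0 big1 // => i _; rewrite part0 mul0r.
- rewrite mulrDl -scalerAl part_linear hu hv scaler_sumr -big_split /=.
  by apply: eq_bigr => i _; rewrite part_linear mulrDl scalerAl.
move: q (gen_xy q); apply: lspan_ind => [|t u v hu hv|_ [w' ->]].
- by rewrite mulr0 part0 big1 // => i _; rewrite part0 mulr0.
- rewrite mulrDr -scalerAr part_linear hu hv scaler_sumr -big_split /=.
  by apply: eq_bigr => i _; rewrite part_linear mulrDr scalerAr.
rewrite -eval_word_cat part_word size_cat.
have [le_w|lt_w] := leqP (size w) r.
  rewrite (bigD1 (Ordinal (le_w : size w < r.+1)%N)) //= !part_word eqxx.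
  rewrite big1 ?addr0 => [|i ne_i].
    have -> : (size w' == r - size w)%N = (size w + size w' == r)%N by lia.
    by case: ifP; rewrite ?mulr0 // eval_word_cat.
  rewrite part_word ifN ?mul0r //; apply: contraNneq ne_i => wi.
  by apply/eqP/val_inj.
rewrite ifN; last by lia.
rewrite big1 // => i _; rewrite part_word ifN ?mul0r //.
by have := ltn_ord i; lia.
Qed.

Lemma part_commutator r a z :
  part r ⟦a, z⟧ = \sum_(i < r.+1) ⟦part i a, part (r - i) z⟧.
Proof.
rewrite [LHS]partB !partM /commutator sumrB; congr (_ - _).
rewrite (reindex_inj rev_ord_inj); apply: eq_bigr => i _; rewrite /= subSS.
by have -> : (r - (r - i))%N = i by have := ltn_ord i; lia.
Qed.

Lemma part_lcs k r z : z \in lcs k -> part r z \in graded_lcs x y k r.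
Proof.
case: k => [|k]; first by move=> _; apply: part_mem.
elim: k r z => [|k IH] r z; first by move=> _; apply: part_mem.
move: z; apply: lcs_linear => [t u v|a z zL]; first exact: part_linear.
rewrite part_commutator; apply: rpred_sum => i _.
apply: (graded_lcs_comm (part_mem i a) (IH (r - i)%N z zL)).
by have := ltn_ord i; lia.
Qed.

Lemma part_ideal (J : submodClosed F) (P : F) r p :
    (forall a b, a \in J -> b * a \in J) -> (forall a b, a \in J -> a * b \in J) ->
    (forall i, part i P \in J) ->
  p \in ideal_gen P -> part r p \in J.
Proof.
move=> JMl JMr PJ; apply: lspan_linear => [t u v|_ [a [b ->]]].
  exact: part_linear.
rewrite partM; apply: rpred_sum => i _; apply: JMr; rewrite partM.
by apply: rpred_sum => j _; apply: JMl.
Qed.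

End HomogeneousPart.

(** * The grading of the free algebra *)

Lemma ord2_neq0 (i : 'I_2) : i != ord0 -> i = ord_max.
Proof. by case: i => [[|[|//]]] //= lti _; apply: val_inj. Qed.

Section FreeAlgebra.
Variable K : fieldType.
Local Notation F := (freealg K 2).
Implicit Types (p q a b z : F) (w : seq bool) (s : {fmonom 'I_2}) (r : nat).

Definition gen (i : 'I_2) : F := << fmu i >>.
Let x := gen ord0.
Let y := gen ord_max.

Definition bits (s : {fmonom 'I_2}) : seq bool :=
  [seq i == ord0 | i <- (s : seq 'I_2)].

Lemma freealg_word s : << s >> = eval_word x y (bits s) :> F.
Proof.
case: s => s; rewrite /bits /=; elim: s => [|i s IH].
  rewrite /eval_word big_nil.
  have -> : FMonom [::] = mone :> {fmonom 'I_2} by apply: val_inj; rewrite /= fm1.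
  by [].
rewrite /= eval_word_cons -IH.
have -> : FMonom (i :: s) = mmul (fmu i) (FMonom s) :> {fmonom 'I_2}.
  by apply: val_inj; rewrite /= fmM fmU.
have -> : letter x y (i == ord0) = gen i.
  by have [->|/ord2_neq0->] := eqVneq i ord0.
rewrite [RHS](_ : _ = @GRing.mul {malg K[{fmonom 'I_2}]} << fmu i >> << FMonom s >>) //.
by rewrite malgM_def fgmulUU mulr1.
Qed.

Lemma freealg_sum p :
  p = \sum_(s <- words p) coef s p *: eval_word x y (bits s).
Proof.
rewrite [LHS](monalgE p); apply: eq_bigr => s _; rewrite -freealg_word.
apply/malgP => s'; rewrite [RHS]mcoeffZ.
by rewrite [LHS]mcoeffU [X in _ * X]mcoeffU mulr_natr.
Qed.

Lemma freealg_gen p : p \in lspan [set a | exists w, a = eval_word x y w].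
Proof.
rewrite [p]freealg_sum; apply: rpred_sum => s _; apply: rpredZ.
by apply: mem_span; exists (bits s).
Qed.

Definition homog_part r p : F :=
  [malg s in msupp p => if fdeg s == r then p@_s else 0].

Lemma homog_partE r p s : (homog_part r p : {malg K[{fmonom 'I_2}]})@_s =
  if fdeg s == r then (p : {malg K[{fmonom 'I_2}]})@_s else 0.
Proof.
rewrite [LHS]mcoeffE; case: ifPn => // /mcoeff_outdom ->.
by rewrite if_same.
Qed.

Lemma homog_part_linear r (t : K) p q :
  homog_part r (t *: p + q) = t *: homog_part r p + homog_part r q.
Proof.
apply/malgP => s; rewrite [RHS]mcoeffD [X in _ = X + _]mcoeffZ !homog_partE.
rewrite [X in if _ then X else _]mcoeffD [X in if _ then X + _ else _]mcoeffZ.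
by case: ifP => // _; rewrite mulr0 addr0.
Qed.

Lemma homog_part_id r p : fhomog r p -> homog_part r p = p.
Proof.
move=> hp; apply/malgP => s; rewrite homog_partE.
have [ps|/mcoeff_outdom->] := boolP (s \in msupp p); last by rewrite if_same.
by rewrite (hp s ps) eqxx.
Qed.

Lemma homog_part_neq r j p : fhomog j p -> j != r -> homog_part r p = 0.
Proof.
move=> hp jr; apply/malgP => s; rewrite homog_partE [RHS]mcoeff0.
have [ps|/mcoeff_outdom->] := boolP (s \in msupp p); last by rewrite if_same.
by rewrite (hp s ps) (negbTE jr).
Qed.

Lemma fhomog_word w : fhomog (size w) (eval_word x y w).
Proof.
have -> : eval_word x y w = << FMonom [seq if t then ord0 else ord_max | t <- w] >>.
  rewrite freealg_word /bits -map_comp; congr (eval_word x y _).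
  by rewrite -[LHS]map_id; apply: eq_map => -[].
move=> s; rewrite /words msuppU1 in_fset1 => /eqP ->.
by rewrite fdegE /= size_map.
Qed.

Lemma homog_part_word r w :
  homog_part r (eval_word x y w) = if size w == r then eval_word x y w else 0.
Proof.
case: eqVneq => [<-|]; first exact/homog_part_id/fhomog_word.
exact/homog_part_neq/fhomog_word.
Qed.

End FreeAlgebra.

(** * Images under algebra morphisms *)

Section Morphism.
Variables (K : fieldType) (F A : algType K) (phi : {lrmorphism F -> A}).
Hypothesis phi_surj : forall a, exists p, a = phi p.
Variables (x y : F).

Lemma eval_word_morph w : phi (eval_word x y w) = eval_word (phi x) (phi y) w.
Proof. by rewrite rmorph_prod; apply: eq_bigr => -[]. Qed.

Lemma commutator_morph (a b : F) : phi ⟦a, b⟧ = ⟦phi a, phi b⟧.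
Proof. by rewrite /commutator rmorphB !rmorphM. Qed.

Lemma graded_lcs_morph k r z : z \in graded_lcs x y k r ->
  phi z \in graded_lcs (phi x) (phi y) k r.
Proof.
have word_mor n a : a \in word_span x y n -> phi a \in word_span (phi x) (phi y) n.
  apply: lspan_linear => [t u v|_ [w wn ->]]; first exact: linearP.
  by rewrite eval_word_morph -wn word_span_word.
case: k => [|k]; first exact: word_mor.
elim: k r z => [|k IH] r z; first exact: word_mor.
apply: lspan_linear => [t u v|_ [i [a [j [l [ijr aH lL ->]]]]]]; first exact: linearP.
rewrite commutator_morph; apply: graded_lcs_comm (word_mor _ _ aH) _ ijr.
exact: IH.
Qed.

Lemma lcs_lift k a : a \in lcs k -> exists2 z, z \in lcs k & a = phi z.
Proof.
have lift0 (U : submodClosed F) : exists2 z, z \in U & 0 = phi z.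
  by exists 0; rewrite ?rpred0 ?rmorph0.
have lift_lin (U : submodClosed F) (t : K) u v :
    (exists2 z, z \in U & u = phi z) -> (exists2 z, z \in U & v = phi z) ->
    exists2 z, z \in U & t *: u + v = phi z.
  move=> [z zU ->] [z' z'U ->]; exists (t *: z + z'); last by rewrite linearP.
  by rewrite rpredD ?rpredZ.
case: k => [|k]; first by have [p ->] := phi_surj a; exists p.
elim: k a => [|k IH] a; first by have [p ->] := phi_surj a; exists p.
move: a; apply: (lspan_ind (P := fun a => exists2 z, z \in lcs k.+2 & a = phi z))
  => [|t u v|_ [b _] [l /IH[z zL ->] <-]].
- exact: lift0.
- exact: lift_lin.
have [p ->] := phi_surj b; exists ⟦p, z⟧; first exact: lcs_commr.
by rewrite commutator_morph.
Qed.

Lemma lcs_ideal_lift k a :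
  a \in lcs_ideal k -> exists2 z, z \in lcs_ideal k & a = phi z.
Proof.
move: a; apply: (lspan_ind (P := fun a => exists2 z, z \in lcs_ideal k & a = phi z))
  => [|t u v [z zU ->] [z' z'U ->]|_ [b _] [l /lcs_lift[z zL ->] <-]].
- by exists 0; rewrite ?rpred0 ?rmorph0.
- exists (t *: z + z'); last by rewrite linearP.
  by rewrite rpredD ?rpredZ.
have [p ->] := phi_surj b; exists (p * z); first exact: mem_lcs_ideal.
by rewrite rmorphM.
Qed.

End Morphism.

(** * Squarefree binary forms *)

Section SquarefreeForm.
Variable K : fieldType.
Let X : mpoly.mpoly 2 K := mpoly.mpolyX K (mpoly.mnm1 ord0).
Let Y : mpoly.mpoly 2 K := mpoly.mpolyX K (mpoly.mnm1 ord_max).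

Lemma linear_form_lin (l : mpoly.mpoly 2 K) :
  l \is mpoly.ishomog1 1 mpoly.mdeg -> exists v, l = lin X Y v.
Proof.
move=> /mpoly.dhomogP l_hom; rewrite [l]mpoly.mpolyE big_seq.
elim/big_ind: _ => [|_ _ [v ->] [w ->]|m /l_hom/eqP/mpoly.mdeg1P[i /eqP ->]].
- by exists (0, 0); rewrite /lin !scale0r addr0.
- by exists (v.1 + w.1, v.2 + w.2); rewrite /lin !scalerDl addrACA.
set c := mpoly.mcoeff _ _.
have [->|/ord2_neq0->] := eqVneq i ord0.
  by exists (c, 0); rewrite /lin scale0r addr0.
by exists (0, c); rewrite /lin scale0r add0r.
Qed.

Lemma lin_proportional (C : comAlgType K) (x y : C) (v w : K * K) :
  w != 0 -> det2 v w = 0 -> exists c, lin x y v = c *: lin x y w.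
Proof.
case: v w => [a b] [c d]; rewrite /det2 /lin /= => w_neq0 /eqP.
rewrite subr_eq0 => /eqP ad_bc.
have [c0|c_neq0] := eqVneq c 0.
  have d_neq0 : d != 0 by apply: contraNneq w_neq0 => ->; rewrite c0.
  have a0 : a = 0.
    by apply/eqP; move/eqP: ad_bc; rewrite c0 mulr0 mulf_eq0 (negbTE d_neq0) orbF.
  by exists (b / d); rewrite c0 a0 !scale0r !add0r scalerA mulfVK.
exists (a / c); rewrite scalerDr !scalerA mulfVK //.
by congr (_ + _ *: _); rewrite mulrAC ad_bc mulfK.
Qed.

Lemma squarefree_prod_lin d (Q : mpoly.mpoly 2 K) : squarefree_form d Q ->
  exists ls, [/\ size ls = d, all (fun v => v != 0) ls,
    pairwise (fun v w => det2 v w != 0) ls & Q = prod_lin X Y ls].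
Proof.
move=> [l [l_neq0 l_hom l_prop ->]].
have [v vP] := choice (fun i => linear_form_lin (l_hom i)).
have v_neq0 i : v i != 0.
  apply: contraNneq (l_neq0 i) => v0; rewrite vP v0.
  by rewrite /lin !scale0r addr0.
exists [seq v i | i <- enum 'I_d]; split.
- by rewrite size_map size_enum_ord.
- by rewrite all_map; apply/allP => i _ /=.
- rewrite pairwise_map; apply: sub_pairwise (_ : pairwise [rel i j | i != j] _).
    move=> i j /= ij; apply: (contra_notN (P := exists c, l i = c *: l j)).
      by move=> /eqP/(lin_proportional X Y (v_neq0 j)); rewrite -!vP.
    by move=> [c]; apply/eqP/l_prop.
  by rewrite -uniq_pairwise enum_uniq.
by rewrite /prod_lin big_map big_enum; apply: eq_bigr => i _; exact: vP.
Qed.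

End SquarefreeForm.

(** * The quotient algebra *)

Section Quotient.
Variables (K : fieldType) (d : nat) (P : freealg K 2).
Hypotheses (K0 : [pchar K] =i pred0) (d_gt0 : (0 < d)%N) (homP : fhomog d P).
Hypothesis sqfreeP : squarefree_form d (abelianization P).

Local Notation A := (quot_alg d_gt0 homP).
Let phi : {lrmorphism freealg K 2 -> A} := alg_proj (fhomog_proper d_gt0 homP).
Let x : A := phi (gen K ord0).
Let y : A := phi (gen K ord_max).

Let phi_surj (a : A) : exists p, a = phi p.
Proof. exact: alg_proj_surj. Qed.

Let gen_xy (a : A) : a \in lspan [set a | exists w, a = eval_word x y w].
Proof.
have [p ->] := phi_surj a.
apply: (lspan_linear (f := phi) _ _ (freealg_gen p)) => [t u v|_ [w ->]].
  exact: linearP.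
by apply: mem_span; exists w; rewrite /phi eval_word_morph.
Qed.

Let phiP : phi P = 0.
Proof.
rewrite -(raddf0 phi); apply/alg_proj_eq; rewrite subr0.
by apply: mem_span; exists 1, 1; rewrite mul1r mulr1.
Qed.

Let part_linear := @homog_part_linear K.
Let part_word := @homog_part_word K.
Let F_gen := @freealg_gen K.

Let homog_part_ideal r p : p \in ideal_gen P -> homog_part r p \in ideal_gen P.
Proof.
apply: (part_ideal F_gen part_linear part_word) => [a b|a b|i].
- exact: ideal_genMl.
- exact: ideal_genMr.
have [<-|di] := eqVneq d i; last by rewrite (homog_part_neq homP di) rpred0.
by rewrite homog_part_id //; apply: mem_span; exists 1, 1; rewrite mul1r mulr1.
Qed.

(* The ideal of [P] is graded, so it contains the component of degree [r] of
   [p - z]. *)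
Let homog_lift r p z : fhomog r p -> phi p = phi z -> phi p = phi (homog_part r z).
Proof.
move=> hp /alg_proj_eq /(homog_part_ideal r).
rewrite (partB part_linear) (homog_part_id hp) => hz.
exact/alg_proj_eq.
Qed.

Let section_abelianization p : mod_ideal2 (section x y (abelianization p)) (phi p).
Proof.
rewrite [p in phi p]freealg_sum raddf_sum /abelianization /mod_ideal2.
elim/big_ind2: _ => [|q a q' a' qa q'a'|s _].
- by rewrite /section mpoly.mmap0 subrr rpred0.
- by rewrite sectionD opprD addrACA; apply: rpredD.
rewrite sectionZ [X in _ - X]linearZ -scalerBr; apply: rpredZ.
rewrite [X in _ - X]eval_word_morph.
have := section_word x y (bits s); rewrite /mod_ideal2.
suff -> : \prod_(i <- (s : seq 'I_2)) mpoly.mpolyX K (mpoly.mnm1 i) =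
    prod_lin (mpoly.mpolyX K (mpoly.mnm1 ord0)) (mpoly.mpolyX K (mpoly.mnm1 ord_max))
      (map (letter_form K) (bits s)) by [].
rewrite /prod_lin !big_map; apply: eq_bigr => i _; rewrite /lin.
have [->|/ord2_neq0->] := eqVneq i ord0; first by rewrite scale1r scale0r addr0.
by rewrite scale0r scale1r add0r.
Qed.

Let graded_vanish k r z : (2 * d + 2 * k - 1 <= r)%N ->
  z \in graded_lcs x y k.+2 r -> z \in lcs k.+3.
Proof.
elim: k r z => [|k IH] r z le_r.
  have [ls [size_ls ls_neq0 ls_det lsP]] := squarefree_prod_lin sqfreeP.
  apply: (graded_lcs2 K0 gen_xy _ ls_neq0 ls_det); rewrite ?size_ls //; last by lia.
  rewrite -lsP; have := section_abelianization P; rewrite /mod_ideal2 phiP.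
  by rewrite subr0.
by apply: (graded_lcs_step K0 gen_xy IH); lia.
Qed.

Lemma Bdeg_quot_eq0 m r : (2 <= m)%N -> (2 * d + 2 * m - 5 <= r)%N ->
  Bdeg (quot_deg d_gt0 homP) m r = [set 0]%classic.
Proof.
case: m => [|[|k]] // _ le_r; apply/seteqP; split=> [_ [u [p hp pu] <-]|_ ->].
  rewrite /= -(raddf0 (mproj _)); apply/mproj_eq; rewrite subr0.
  change (is_true (val u \in lcs k.+3)); rewrite -pu.
  have [z zL uz] := lcs_lift phi_surj (valP u).
  rewrite -[alg_proj _ p]/(phi p) (homog_lift hp (etrans pu uz)).
  apply: (graded_vanish (r := r)); first by lia.
  exact/graded_lcs_morph/(part_lcs F_gen part_linear part_word).
exists 0; last exact: raddf0.
by exists 0; rewrite ?raddf0 //= => s; rewrite /words msupp0.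
Qed.

Lemma Ndeg_quot_eq0 m r : (2 <= m)%N -> (2 * d + 2 * m - 4 <= r)%N ->
  Ndeg (quot_deg d_gt0 homP) m r = [set 0]%classic.
Proof.
case: m => [|[|k]] // _ le_r; apply/seteqP; split=> [_ [u [p hp pu] <-]|_ ->].
  rewrite /= -(raddf0 (mproj _)); apply/mproj_eq; rewrite subr0.
  change (is_true (val u \in lcs_ideal k.+3)); rewrite -pu.
  have [z zM uz] := lcs_ideal_lift phi_surj (valP u).
  rewrite -[alg_proj _ p]/(phi p) (homog_lift hp (etrans pu uz)).
  move: {uz} z zM; apply: lspan_linear => [t a b|_ [a _] [l lL <-]].
    by rewrite part_linear linearP.
  rewrite (partM F_gen part_linear part_word) rmorph_sum.
  apply: rpred_sum => i _; rewrite rmorphM.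
  have vanish r' := @graded_vanish k r'.
  apply: (graded_lcs_ideal gen_xy vanish (i := i) (j := (r - i)%N)).
  - by have := ltn_ord i; lia.
  - exact/(graded_lcs_morph phi (k := 1))/(part_mem F_gen part_linear part_word).
  - exact/graded_lcs_morph/(part_lcs F_gen part_linear part_word).
exists 0; last exact: raddf0.
by exists 0; rewrite ?raddf0 //= => s; rewrite /words msupp0.
Qed.

End Quotient.

Theorem proposition11p1 (R : realType) (d : nat) (P : freealg R[i] 2)
    (d_gt0 : (1 <= d)%N) (homP : fhomog d P)
    (sqfreeP : squarefree_form d (abelianization P)) :
  let A := quot_alg d_gt0 homP in
  let gr : nat -> set A := quot_deg d_gt0 homP in
  (forall m r : nat, (2 <= m)%N -> (2 * d + 2 * m - 5 <= r)%N ->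
     Bdeg gr m r = [set 0]) /\
  (forall m r : nat, (2 <= m)%N -> (2 * d + 2 * m - 4 <= r)%N ->
     Ndeg gr m r = [set 0]).
Proof.
have K0 : [pchar R[i]] =i pred0 := Num.Theory.pchar_num _.
split=> m r m2 le_r; first exact: Bdeg_quot_eq0.
exact: Ndeg_quot_eq0.
Qed.
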